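(* Every doubly distributive skew hyperfield is (isomorphic to) a quotient $K/U$ of a skew field $K$ by some normal subgroup $U$ of $K^\times$.
   Context: A hyperoperation on a set $S$ is a map $\boxplus$ from $S\times S$ to the nonempty subsets of $S$; for nonempty $A,B\subseteq S$ put $A\boxplus B=\bigcup_{a\in A,b\in B}a\boxplus b$; $\boxplus$ is associative if $a\boxplus(b\boxplus c)=(a\boxplus b)\boxplus c$ for all $a,b,c$. A hypergroup is $(G,\boxplus,0)$ with $\boxplus$ an associative hyperoperation such that: $0\boxplus x=x\boxplus 0=\{x\}$ for all $x$; for every $x$ there is a unique $x'$ with $0\in x\boxplus x'$ and a unique $x''$ with $0\in x''\boxplus x$, and $x'=x''$, denoted $-x$; and $x\in y\boxplus z$ if and only if $-x\in -z\boxplus -y$. It is commutative if $y\boxplus z=z\boxplus y$ for all $y,z$. A skew hyperring is $(R,\odot,\boxplus,1,0)$ with $(R,\odot,1)$ a monoid, $(R,\boxplus,0)$ a commutative hypergroup, $x\odot 0=0\odot x=0$, and $a\odot(x\boxplus y)=(a\odot x)\boxplus(a\odot y)$, $(x\boxplus y)\odot a=(x\odot a)\boxplus(y\odot a)$. A skew hyperfield is a skew hyperring with $0\ne1$ in which every nonzero element has a multiplicative inverse. It is doubly distributive if $(a\boxplus b)(c\boxplus d)=ac\boxplus ad\boxplus bc\boxplus bd$ for all $a,b,c,d$ (products of sets being taken elementwise). For a skew field $K$ and a normal subgroup $U$ of $K^\times$, the quotient $K/U$ is the skew hyperfield with ground set $\{[g]=gU\mid g\in K\}$, multiplication $[g]\cdot[h]=[gh]$,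 and hyperaddition $[g]\boxplus[0]=[0]\boxplus[g]=\{[g]\}$ and $[g]\boxplus[h]=\{[f]\mid f\in gU+hU\}$ for nonzero $[g],[h]$. Isomorphisms of skew hyperfields are bijections preserving $0$, $1$, multiplication and hyperaddition. *)

(* Defs.v *)
From HB Require Import structures.
From mathcomp Require Import all_boot all_algebra.
From mathcomp Require Import boolp classical_sets.

Set Implicit Arguments.
Unset Strict Implicit.
Unset Printing Implicit Defensive.

Import GRing.Theory.
Local Open Scope classical_set_scope.
Local Open Scope ring_scope.

Definition hyper_lift (S : Type) (op : S -> S -> set S) (A B : set S) : set S :=
  \bigcup_(a in A) \bigcup_(b in B) op a b.

(* The two inverse laws together say that [hopp x] is the unique right inverse
   of [x] and also its unique left inverse. *)
HB.mixin Record isHypergroup (G : Type) := {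
  hzero : G;
  hadd : G -> G -> set G;
  hopp : G -> G;
  hadd_nonempty : forall x y, hadd x y !=set0;
  haddA : forall a b c,
    hyper_lift hadd [set a] (hadd b c) = hyper_lift hadd (hadd a b) [set c];
  hadd0x : forall x, hadd hzero x = [set x];
  haddx0 : forall x, hadd x hzero = [set x];
  hadd_rinv : forall x y, hadd x y hzero <-> y = hopp x;
  hadd_linv : forall x y, hadd y x hzero <-> y = hopp x;
  hadd_rev : forall x y z, hadd y z x <-> hadd (hopp z) (hopp y) (hopp x)
}.

#[short(type="hypergroupType")]
HB.structure Definition Hypergroup := {G of isHypergroup G}.

HB.mixin Record isComHypergroup (G : Type) of Hypergroup G := {
  haddC : forall x y : G, hadd x y = hadd y x
}.

#[short(type="comHypergroupType")]
HB.structure Definition ComHypergroup := {G of isComHypergroup G & Hypergroup G}.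

HB.mixin Record isSkewHyperring (R : Type) of ComHypergroup R := {
  hone : R;
  hmul : R -> R -> R;
  hmulA : forall x y z, hmul x (hmul y z) = hmul (hmul x y) z;
  hmul1x : forall x, hmul hone x = x;
  hmulx1 : forall x, hmul x hone = x;
  hmul0x : forall x, hmul hzero x = hzero;
  hmulx0 : forall x, hmul x hzero = hzero;
  hmulDr : forall a x y : R,
    [set hmul a t | t in hadd x y] = hadd (hmul a x) (hmul a y);
  hmulDl : forall a x y : R,
    [set hmul t a | t in hadd x y] = hadd (hmul x a) (hmul y a)
}.

#[short(type="skewHyperringType")]
HB.structure Definition SkewHyperring :=
  {R of isSkewHyperring R & ComHypergroup R}.

HB.mixin Record isSkewHyperfield (F : Type) of SkewHyperring F := {
  hzero_neq1 : (hzero : F) <> hone;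
  hinv_exists : forall x : F, x <> hzero ->
    exists y : F, hmul x y = hone /\ hmul y x = hone
}.

#[short(type="skewHyperfieldType")]
HB.structure Definition SkewHyperfield :=
  {F of isSkewHyperfield F & SkewHyperring F}.

Definition doubly_distributive (F : skewHyperfieldType) : Prop :=
  forall a b c d : F,
    [set hmul x y | x in hadd a b & y in hadd c d] =
    hyper_lift hadd
      (hyper_lift hadd (hadd (hmul a c) (hmul a d)) [set hmul b c])
      [set hmul b d].

Definition hyperfield_iso (F G : skewHyperfieldType) (f : F -> G) : Prop :=
  [/\ bijective f, f hzero = hzero, f hone = hone,
      forall x y, f (hmul x y) = hmul (f x) (f y) &
      forall x y, f @` hadd x y = hadd (f x) (f y)].

Definition hyperfield_isomorphic (F G : skewHyperfieldType) : Prop :=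
  exists f : F -> G, hyperfield_iso f.

HB.mixin Record isSkewField (K : Type) of GRing.UnitRing K := {
  neq0_unit : forall x : K, x != 0 -> x \is a GRing.unit
}.

#[short(type="skewFieldType")]
HB.structure Definition SkewField := {K of isSkewField K & GRing.UnitRing K}.

(* A normal subgroup of the group of nonzero elements, as a subset of [K]. *)
Record normal_unit_subgroup (K : skewFieldType) := NormalUnitSubgroup {
  nus_set :> set K;
  nus_neq0 : forall u, nus_set u -> u != 0;
  nus1 : nus_set 1;
  nusM : forall u v, nus_set u -> nus_set v -> nus_set (u * v);
  nusV : forall u, nus_set u -> nus_set u^-1;
  nusJ : forall g u, g != 0 -> nus_set u -> nus_set (g * u * g^-1)
}.

Section Quotient.
Variables (K : skewFieldType) (U : normal_unit_subgroup K).
Implicit Types (g h f u v : K).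

Definition ucoset g : set K := [set g * u | u in U].

Definition quot : Type := {A : set K | exists g, A = ucoset g}.

Definition qclass g : quot := exist _ (ucoset g) (ex_intro _ g erefl).

Implicit Types (A B C X : quot).

Let quot_inj A B : sval A = sval B -> A = B.
Proof.
case: A B => [A pA] [B pB] /= eAB; case: _ / eAB in pB *.
by congr exist; exact: Prop_irrelevance.
Qed.

Lemma qclass_surj A : exists g, A = qclass g.
Proof. by case: A => [A [g eA]]; exists g; apply: quot_inj. Qed.

Lemma qclassP g A : sval A g <-> A = qclass g.
Proof.
split=> [|->]; last by exists 1; [exact: nus1 | rewrite mulr1].
have [h ->] := qclass_surj A; case=> u Uu <-; apply: quot_inj => /=.
have uu : u \is a GRing.unit by apply/neq0_unit/(nus_neq0 Uu).
apply/seteqP; split=> x [v Vv <-]; last first.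
  by exists (u * v); [apply: nusM | rewrite mulrA].
exists (u^-1 * v); first by apply: nusM => //; apply: nusV.
by rewrite mulrA mulrK.
Qed.

Lemma qclass_eq g h : qclass g = qclass h <-> exists2 u, nus_set U u & g = h * u.
Proof.
split=> [e|[u Uu ->]].
  have : sval (qclass h) g by apply/qclassP.
  by case=> u Uu <-; exists u.
by apply/esym/qclassP; exists u.
Qed.

Lemma nus_comm g u : nus_set U u -> exists2 v, nus_set U v & u * g = g * v.
Proof.
have [->|g0] := eqVneq g 0; first by exists u; rewrite // mulr0 mul0r.
move=> Uu; have ug := neq0_unit g g0.
exists (g^-1 * u * g); last by rewrite mulrA mulVKr.
rewrite -{2}[g]invrK; apply: nusJ => //.
by apply/eqP=> e; move: ug; rewrite -unitrV e unitr0.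
Qed.

Let qmul_subproof A B :
  exists g, [set a * b | a in sval A & b in sval B] = ucoset g.
Proof.
have [g ->] := qclass_surj A; have [h ->] := qclass_surj B; exists (g * h).
apply/seteqP; split=> [x [_ [u Uu <-] [_ [v Uv <-] <-]]|x [u Uu <-]].
  have [w Uw e] := nus_comm h Uu; exists (w * v); first exact: nusM.
  by rewrite -[g * u * _]mulrA [u * _]mulrA e !mulrA.
exists g; first by exists 1; [exact: nus1 | rewrite mulr1].
by exists (h * u); [exists u | rewrite mulrA].
Qed.

(* The setwise product of two cosets; [qmulE] below gives [g][h] = [gh]. *)
Definition qmul A B : quot :=
  exist _ [set a * b | a in sval A & b in sval B] (qmul_subproof A B).

Lemma qmulE g h : qmul (qclass g) (qclass h) = qclass (g * h).
Proof.
apply/qclassP; exists g; first by apply/qclassP.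
by exists h => //; apply/qclassP.
Qed.

Definition qadd A B : set quot :=
  if `[< A = qclass 0 >] then [set B]
  else if `[< B = qclass 0 >] then [set A]
  else [set qclass f | f in [set a + b | a in sval A & b in sval B]].

Let qopp_subproof A : exists g, [set - a | a in sval A] = ucoset g.
Proof.
have [g ->] := qclass_surj A; exists (- g).
apply/seteqP; split=> [x [_ [u Uu <-] <-]|x [u Uu <-]].
  by exists u; rewrite ?mulNr.
by exists (g * u); [exists u | rewrite mulNr].
Qed.

Definition qopp A : quot := exist _ [set - a | a in sval A] (qopp_subproof A).

Lemma qoppE g : qopp (qclass g) = qclass (- g).
Proof. by apply/qclassP; exists g => //; apply/qclassP. Qed.

Lemma qclass_eq0 g : qclass g = qclass 0 -> g = 0.
Proof. by case/qclass_eq=> u _; rewrite mul0r. Qed.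

Lemma qaddP A B C :
  qadd A B C <-> exists a b, [/\ A = qclass a, B = qclass b & C = qclass (a + b)].
Proof.
rewrite /qadd; case: asboolP => [->|A0].
  split=> [->|[a [b [ea -> ->]]]].
    by have [b ->] := qclass_surj B; exists 0, b; rewrite add0r.
  by rewrite (qclass_eq0 (esym ea)) add0r.
case: asboolP => [->|B0].
  split=> [->|[a [b [-> eb ->]]]].
    by have [a ->] := qclass_surj A; exists a, 0; rewrite addr0.
  by rewrite (qclass_eq0 (esym eb)) addr0.
split=> [[f [a /qclassP Aa [b /qclassP Bb <-]] <-]|[a [b [Aa Bb ->]]]].
  by exists a, b.
exists (a + b) => //.
by exists a; [exact/qclassP | exists b => //; exact/qclassP].
Qed.

Let qadd_nonempty A B : qadd A B !=set0.
Proof.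
have [a Aa] := qclass_surj A; have [b Bb] := qclass_surj B.
by exists (qclass (a + b)); apply/qaddP; exists a, b.
Qed.

Let qaddC A B : qadd A B = qadd B A.
Proof.
by apply/seteqP; split=> C /qaddP [a [b [? ? ->]]]; apply/qaddP; exists b, a;
   rewrite addrC.
Qed.

Let qadd3P A B C X : hyper_lift qadd [set A] (qadd B C) X <->
  exists a b c, [/\ A = qclass a, B = qclass b, C = qclass c &
                    X = qclass (a + (b + c))].
Proof.
split=> [[_ -> [T /qaddP [b [c [-> -> ->]]]]]|[a [b [c [-> -> -> ->]]]]].
  case/qaddP=> a [s [-> /esym/qclass_eq [u Uu ->] ->]].
  exists a, (b * u), (c * u); rewrite mulrDl; split=> //;
    by apply/esym/qclass_eq; exists u.
exists (qclass a) => //; exists (qclass (b + c)); apply/qaddP.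
  by exists b, c.
by exists a, (b + c).
Qed.

Let qaddA A B C :
  hyper_lift qadd [set A] (qadd B C) = hyper_lift qadd (qadd A B) [set C].
Proof.
have -> : hyper_lift qadd (qadd A B) [set C] =
          hyper_lift qadd [set C] (qadd B A).
  rewrite /hyper_lift (qaddC A) bigcup_set1.
  by apply: eq_bigcupr => T _; rewrite bigcup_set1 qaddC.
apply/seteqP; split=> X /qadd3P [a [b [c [-> -> -> ->]]]]; apply/qadd3P;
  by exists c, b, a; split=> //; rewrite addrCA addrC -addrA addrC -addrA addrCA.
Qed.

Let qadd0x A : qadd (qclass 0) A = [set A].
Proof. by rewrite /qadd; case: asboolP. Qed.

Let qaddx0 A : qadd A (qclass 0) = [set A].
Proof. by rewrite qaddC qadd0x. Qed.

Let qadd_rinv A B : qadd A B (qclass 0) <-> B = qopp A.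
Proof.
split=> [/qaddP [a [b [-> -> /esym/qclass_eq0/eqP]]]|->].
  by rewrite addrC addr_eq0 qoppE => /eqP ->.
have [a ->] := qclass_surj A; apply/qaddP.
by exists a, (- a); rewrite subrr qoppE.
Qed.

Let qadd_linv A B : qadd B A (qclass 0) <-> B = qopp A.
Proof. by rewrite qaddC; apply: qadd_rinv. Qed.

Let qadd_rev A B C : qadd B C A <-> qadd (qopp C) (qopp B) (qopp A).
Proof.
have oppK D : qopp (qopp D) = D.
  by have [d ->] := qclass_surj D; rewrite !qoppE opprK.
suff imp A' B' C' : qadd B' C' A' -> qadd (qopp C') (qopp B') (qopp A').
  by split=> [|/imp]; [apply: imp | rewrite !oppK].
case/qaddP=> b [c [-> -> ->]]; apply/qaddP.
by exists (- c), (- b); rewrite !qoppE opprD addrC.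
Qed.

HB.instance Definition _ := @isHypergroup.Build quot (qclass 0) qadd qopp
  qadd_nonempty qaddA qadd0x qaddx0 qadd_rinv qadd_linv qadd_rev.
HB.instance Definition _ := isComHypergroup.Build quot qaddC.

Let qmulA A B C : qmul A (qmul B C) = qmul (qmul A B) C.
Proof.
have [[[a ->] [b ->]] [c ->]] := (qclass_surj A, qclass_surj B, qclass_surj C).
by rewrite !qmulE mulrA.
Qed.

Let qmul1x A : qmul (qclass 1) A = A.
Proof. by have [a ->] := qclass_surj A; rewrite qmulE mul1r. Qed.

Let qmulx1 A : qmul A (qclass 1) = A.
Proof. by have [a ->] := qclass_surj A; rewrite qmulE mulr1. Qed.

Let qmul0x A : qmul (qclass 0) A = qclass 0.
Proof. by have [a ->] := qclass_surj A; rewrite qmulE mul0r. Qed.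

Let qmulx0 A : qmul A (qclass 0) = qclass 0.
Proof. by have [a ->] := qclass_surj A; rewrite qmulE mulr0. Qed.

Let qinv A : A <> qclass 0 ->
  exists B, qmul A B = qclass 1 /\ qmul B A = qclass 1.
Proof.
have [a -> a0] := qclass_surj A.
have ua : a \is a GRing.unit by apply: neq0_unit; apply/eqP => e; rewrite e in a0.
by exists (qclass a^-1); rewrite !qmulE divrr ?mulVr.
Qed.

Let qmulDr A B C : [set qmul A T | T in qadd B C] = qadd (qmul A B) (qmul A C).
Proof.
have [[[a ->] [b ->]] [c ->]] := (qclass_surj A, qclass_surj B, qclass_surj C).
apply/seteqP; split=> [X [_ /qaddP [b' [c' [-> -> ->]]] <-]|X].
  by apply/qaddP; exists (a * b'), (a * c'); rewrite !qmulE mulrDr.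
rewrite !qmulE => /qaddP [s [t [/esym/qclass_eq [u Uu ->]]]].
move=> /esym/qclass_eq [v Vv ->] ->.
exists (qclass (b * u + c * v)); last by rewrite qmulE mulrDr !mulrA.
apply/qaddP; exists (b * u), (c * v).
by split=> //; apply/esym/qclass_eq; [exists u | exists v].
Qed.

Let qmulDl A B C : [set qmul T A | T in qadd B C] = qadd (qmul B A) (qmul C A).
Proof.
have [[[a ->] [b ->]] [c ->]] := (qclass_surj A, qclass_surj B, qclass_surj C).
apply/seteqP; split=> [X [_ /qaddP [b' [c' [-> -> ->]]] <-]|X].
  by apply/qaddP; exists (b' * a), (c' * a); rewrite !qmulE mulrDl.
have Ucomm u : nus_set U u -> exists2 v, nus_set U v & a * u = v * a.
  have [->|a0] := eqVneq a 0; first by exists u; rewrite // mulr0 mul0r.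
  move=> Uu; exists (a * u * a^-1); first exact: nusJ.
  by rewrite mulrVK // neq0_unit.
rewrite !qmulE => /qaddP [s [t [/esym/qclass_eq [u Uu ->]]]].
move=> /esym/qclass_eq [v Vv ->] ->.
have [[u' Uu' eu] [v' Uv' ev]] := (Ucomm u Uu, Ucomm v Vv).
exists (qclass (b * u' + c * v')); last first.
  by rewrite qmulE mulrDl -!mulrA eu ev.
apply/qaddP; exists (b * u'), (c * v').
by split=> //; apply/esym/qclass_eq; [exists u' | exists v'].
Qed.

HB.instance Definition _ := @isSkewHyperring.Build quot (qclass 1) qmul
  qmulA qmul1x qmulx1 qmul0x qmulx0 qmulDr qmulDl.

Let q0_neq1 : qclass 0 <> qclass 1.
Proof. by move/esym/qclass_eq0/eqP; rewrite oner_eq0. Qed.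

HB.instance Definition _ := isSkewHyperfield.Build quot q0_neq1 qinv.

End Quotient.

(* Main.v *)
(* Let [M = 1 - 1]. Double distributivity makes [x + y] a singleton unless
   [y = -x], and turns [M] into the maximal ideal (if [1] is not in [M]) or the
   valuation ring (if [1] is in [M]) of a valuation on [F] with values in a
   bi-ordered group [G]: the sets [x * M] form a chain, and the larger of two
   elements of different levels absorbs the other. In the first case an element
   together with the elements of its level spans a copy of a residue skew
   field; in the second case each level is {x, -x}, and it is replaced by a copy
   of the rationals with the sign as projection. Either way one obtains a
   [G]-graded ring whose nonzero homogeneous elements are invertible. Its
   Malcev-Neumann completion (series with well-ordered support) is a skew field
   [K], and sending a series to its lowest term identifies [F] with [K/U], where
   [U] consists of the series with lowest term [1].

   A series [f] is inverted without Neumann's lemma on the powers of a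
   well-ordered set: solutions of [f g = 1] up to a given degree are unique, so
   they glue, and the glued solution could be extended by one more term. *)
Require Import Defs.
From HB Require Import structures.
From mathcomp Require Import all_boot all_order all_algebra.
From mathcomp Require Import boolp classical_sets.
From mathcomp Require Import functions cardinality fsbigop.
From mathcomp Require Import ring lra.

Set Implicit Arguments.
Unset Strict Implicit.
Unset Printing Implicit Defensive.

Import Order.TTheory GRing.Theory Num.Theory.
Local Open Scope classical_set_scope.
Local Open Scope ring_scope.

(* All homogeneous components are identified with one abelian group [part], so
   that the multiplication, rather than its type, depends on the degrees. *)
Record graded_division_ring := GradedDivisionRing {
  deg : choiceType;
  part : zmodType;
  dmul : deg -> deg -> deg;
  done1 : deg;
  dinv : deg -> deg;
  dlt : deg -> deg -> Prop;
  dmulA : associative dmul;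
  dmul1x : left_id done1 dmul;
  dmulx1 : right_id done1 dmul;
  dmulVx : left_inverse done1 dinv dmul;
  dmulxV : right_inverse done1 dinv dmul;
  dlt_irr : forall x, ~ dlt x x;
  dlt_trans : forall y x z, dlt x y -> dlt y z -> dlt x z;
  dlt_total : forall x y, [\/ dlt x y, x = y | dlt y x];
  dlt_mul2l : forall x y z, dlt y z -> dlt (dmul x y) (dmul x z);
  dlt_mul2r : forall x y z, dlt y z -> dlt (dmul y x) (dmul z x);
  pmul : deg -> deg -> part -> part -> part;
  pone : part;
  pone_neq0 : pone != 0;
  pmulDl : forall x y a b c, pmul x y (a + b) c = pmul x y a c + pmul x y b c;
  pmulDr : forall x y a b c, pmul x y a (b + c) = pmul x y a b + pmul x y a c;
  pmulA : forall x y z a b c, pmul x (dmul y z) a (pmul y z b c) =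
                              pmul (dmul x y) z (pmul x y a b) c;
  pmul1x : forall x a, pmul done1 x pone a = a;
  pmulx1 : forall x a, pmul x done1 a pone = a;
  pmul_rinv : forall x a, a != 0 -> exists b, pmul x (dinv x) a b = pone
}.

(** * Well-ordered subsets of bi-ordered groups *)

Section OrderedGroup.
Variable D : graded_division_ring.
Local Notation G := (deg D).
Local Notation "x ** y" := (dmul x y) (at level 40, left associativity).
Local Notation "x <o y" := (dlt x y) (at level 70).
Local Notation "x ^i" := (dinv x) (at level 3, format "x ^i").
Implicit Types (x y z k : G) (S T P : set G).

Lemma dmulKV x y : x ** (x^i ** y) = y.
Proof. by rewrite dmulA dmulxV dmul1x. Qed.

Lemma dmulVK x y : x^i ** (x ** y) = y.
Proof. by rewrite dmulA dmulVx dmul1x. Qed.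

Lemma dinvM x y : (x ** y)^i = y^i ** x^i.
Proof.
by rewrite -[RHS](dmulVK (x ** y)) -(dmulA x y) dmulKV dmulxV dmulx1.
Qed.

Lemma dinvK x : x^i^i = x.
Proof. by rewrite -[RHS](dmulVK x^i) dmulVx dmulx1. Qed.

Lemma dlt_inv x y : x <o y -> y^i <o x^i.
Proof.
move/(dlt_mul2l x^i)/(dlt_mul2r y^i).
by rewrite dmulVx dmul1x -dmulA dmulxV dmulx1.
Qed.

Lemma dlt_asym x y : x <o y -> ~ y <o x.
Proof. by move=> xy /(dlt_trans xy); exact: dlt_irr. Qed.

Lemma dlt_nge x y : ~ (x <o y) -> x = y \/ y <o x.
Proof. by case: (dlt_total x y); tauto. Qed.

Definition least P x := P x /\ forall y, P y -> ~ y <o x.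

Definition well_ordered S := forall P, P `<=` S -> P !=set0 -> exists x, least P x.

Lemma well_ordered_sub S T : S `<=` T -> well_ordered T -> well_ordered S.
Proof. by move=> ST wT P PS; apply: wT; apply: subset_trans ST. Qed.

Lemma well_ordered1 x : well_ordered [set x].
Proof.
move=> P Px [y Py]; exists y; split=> // z /Px -> /=.
by rewrite (Px _ Py); exact: dlt_irr.
Qed.

Lemma well_orderedU S T : well_ordered S -> well_ordered T -> well_ordered (S `|` T).
Proof.
move=> wS wT P PST [p Pp].
have [[s [Ps Ss]]|nS] := pselect (exists s, P s /\ S s); last first.
  apply: wT; last by exists p.
  by move=> q Pq; case: (PST q Pq) => // Sq; case: nS; exists q.
have [s1 [[Ps1 Ss1] min1]] := wS (P `&` S) (@subIsetr _ _ _) (ex_intro _ s (conj Ps Ss)).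
have [[t [Pt Tt]]|nT] := pselect (exists t, P t /\ T t); last first.
  exists s1; split=> // y Py; apply: min1; split=> //.
  by case: (PST y Py) => // Ty; case: nT; exists y.
have [t1 [[Pt1 Tt1] min2]] := wT (P `&` T) (@subIsetr _ _ _) (ex_intro _ t (conj Pt Tt)).
have [st|st] := pselect (s1 <o t1).
  exists s1; split=> // y Py ys; case: (PST y Py) => H; first exact: (min1 y).
  by apply: (min2 y) => //; apply: dlt_trans st.
exists t1; split=> // y Py yt; case: (PST y Py) => H; last exact: (min2 y).
apply: (min1 y) => //; case: (dlt_nge st) => [->//|]; exact: dlt_trans.
Qed.

Definition dprod S T : set G := [set x ** y | x in S & y in T].

(* Descending in [P] from [s ** t] with [t] least possible keeps the right
   factor above [t], so that the left factor decreases. *)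
Lemma well_ordered_prod S T : well_ordered S -> well_ordered T ->
  well_ordered (dprod S T).
Proof.
move=> wS wT P PST P0; apply: contrapT => noleast.
pose right Q := [set t | T t /\ exists2 s, S s & Q (s ** t)].
have pick Q : Q `<=` P -> Q !=set0 ->
    exists s t, [/\ S s, Q (s ** t) & least (right Q) t].
  move=> QP [q Qq].
  have [t [[Tt [s Ss Qst]] min]] : exists t, least (right Q) t.
    apply: wT => [t []//|]; have [s Ss [t Tt e]] := PST q (QP q Qq).
    by exists t; split=> //; exists s; rewrite ?e.
  by exists s, t; split=> //; split=> //; split=> //; exists s.
pose below p := [set q | P q /\ ~ p <o q].
pose bad := [set s | S s /\ exists t, P (s ** t) /\ least (right (below (s ** t))) t].
have [s0 [[Ss0 [t0 [Pst0 lt0]]] min0]] : exists s, least bad s.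
  apply: wS => [s []//|].
  have [s [t [Ss Pst lt]]] := pick P (@subset_refl _ P) P0.
  exists s; split=> //; exists t; split=> //; split; last first.
    move=> u [Tu [v Sv [Pvu _]]]; apply: (lt.2); split=> //; exists v => //.
  case: lt => [[Tt _] _]; split=> //; exists s => //; split=> //; exact: dlt_irr.
have [q [Pq qlt]] : exists q, P q /\ q <o s0 ** t0.
  apply: contrapT => nq; apply: noleast; exists (s0 ** t0); split=> // q Pq lq.
  by apply: nq; exists q.
pose Q := [set r | P r /\ r <o s0 ** t0].
(* The new left factor is [bad] again, hence not below [s0]. Its partner [t] will not be below [t0]
   either, so monotonicity contradicts [s ** t <o s0 ** t0]. *)
have [s [t [Ss [Pst stlt] lt]]] := pick Q (fun r => @proj1 _ _) (ex_intro _ q (conj Pq qlt)).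
have bads : bad s.
  split=> //; exists t; split=> //; split.
    case: lt => [[Tt _] _]; split=> //; exists s => //; split=> //; exact: dlt_irr.
  move=> u [Tu [v Sv [Pvu nlt]]]; apply: (lt.2); split=> //; exists v => //.
  by split=> //; case: (dlt_nge nlt) => [<-//|]; move/dlt_trans; apply.
have tt0 : ~ t <o t0.
  apply: (lt0.2); split; first by case: lt => [[]].
  exists s => //; split=> //; exact: dlt_asym.
case: (dlt_nge (min0 s bads)) => [e|s0s]; move: stlt.
  rewrite e => /(dlt_mul2l s0^i); rewrite !dmulVK; exact: tt0.
move=> stlt; apply: (dlt_asym stlt).
case: (dlt_nge tt0) => [->|t0t]; first exact: dlt_mul2r.
by apply: dlt_trans (dlt_mul2r t s0s); exact: dlt_mul2l.
Qed.

(** If [S] were infinite, take the least [b] with infinitely many elements up to it. After removing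
    [b], the greatest remaining element [c] still has infinitely many elements up to it, and [c]
    lies below [b]. *)
Lemma finite_well_ordered_both S : well_ordered S ->
    (forall P, P `<=` S -> P !=set0 -> exists x, P x /\ forall y, P y -> ~ x <o y) ->
  finite_set S.
Proof.
move=> wS rS; apply: contrapT => infS.
pose low x := [set y | S y /\ ~ x <o y].
have inf0 P : infinite_set P -> P !=set0 by exact: infinite_setN0.
have [m [Sm maxm]] := rS S (@subset_refl _ S) (inf0 _ infS).
have [b [[Sb infb] minb]] : exists x, least [set x | S x /\ infinite_set (low x)] x.
  apply: wS => [x []//|]; exists m; split=> // fin; apply: infS.
  by apply: sub_finite_set fin => y Sy; split=> //; apply: maxm.
have infb' : infinite_set (low b `\ b).
  move=> fin; apply: infb; apply: (@sub_finite_set _ _ ([set b] `|` (low b `\ b))).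
    by move=> y ly; case: (pselect (y = b)) => [->|]; [left|right].
  by rewrite finite_setU; split=> //; exact: finite_set1.
have [c [[[Sc cb] cnb] maxc]] := rS (low b `\ b) (fun y h => h.1.1) (inf0 _ infb').
have ltcb : c <o b by case: (dlt_nge cb) => // e; case: cnb.
apply: (minb c) => //; split=> // fin; apply: infb'.
by apply: sub_finite_set fin => y ly; split; [exact: ly.1.1|exact: maxc].
Qed.

(** The left factors inherit the well-order of [S]. Since [k^i ** x] decreases as [k] grows, the
    well-order of [T] provides greatest elements, so the previous lemma applies. *)
Lemma finite_factorizations S T x : well_ordered S -> well_ordered T ->
  finite_set [set k | S k /\ T (k^i ** x)].
Proof.
move=> wS wT; apply: finite_well_ordered_both => [|P PST [p Pp]].
  by apply: well_ordered_sub wS => k [].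
have [t [[k Pk <-] min]] : exists t, least [set k^i ** x | k in P] t.
  apply: wT => [_ [k /PST [_ Tk] <-]//|]; by exists (p^i ** x); exists p.
exists k; split=> // y Py ky; apply: (min (y^i ** x)); first by exists y.
by apply: dlt_mul2r; apply: dlt_inv.
Qed.

End OrderedGroup.

(** * Malcev-Neumann series *)

Section GradedTheory.
Variable D : graded_division_ring.
Local Notation G := (deg D).
Local Notation A := (part D).
Local Notation "x ** y" := (dmul x y) (at level 40, left associativity).
Local Notation "x <o y" := (dlt x y) (at level 70).
Local Notation "x ^i" := (dinv x) (at level 3, format "x ^i").
Implicit Types (x y z : G) (a b c : A).

Lemma pmul0r x y a : pmul x y 0 a = 0.
Proof. by apply: (addrI (pmul x y 0 a)); rewrite -pmulDl !addr0. Qed.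

Lemma pmulr0 x y a : pmul x y a 0 = 0.
Proof. by apply: (addrI (pmul x y a 0)); rewrite -pmulDr !addr0. Qed.

Lemma pmul_suml x y (I : Type) (r : seq I) (h : I -> A) c :
  pmul x y (\sum_(i <- r) h i) c = \sum_(i <- r) pmul x y (h i) c.
Proof.
by apply: (big_morph (fun a => pmul x y a c)) => [a b|]; rewrite ?pmulDl ?pmul0r.
Qed.

Lemma pmul_sumr x y (I : Type) (r : seq I) (h : I -> A) a :
  pmul x y a (\sum_(i <- r) h i) = \sum_(i <- r) pmul x y a (h i).
Proof.
by apply: (big_morph (pmul x y a)) => [b c|]; rewrite ?pmulDr ?pmulr0.
Qed.

Lemma pmul_solve x y a c : a != 0 -> exists b, pmul x y a b = c.
Proof.
move=> /(pmul_rinv x) [b ab]; exists (pmul x^i (x ** y) b c).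
rewrite -[y in pmul x y](dmulVK x) pmulA ab dmulxV.
by rewrite pmul1x.
Qed.

(** As in a group: a right inverse [b] of [a] has a right inverse [c], and associativity of the
    product of [a], [b], [c] forces [c = a]. *)
Lemma pmul_linv x a : a != 0 -> exists b, pmul x^i x b a = pone D.
Proof.
move=> /(pmul_rinv x) [b ab].
have b0 : b != 0.
  apply/eqP => b0; move: ab; rewrite b0 pmulr0 => /esym/eqP.
  by apply/negP; exact: pone_neq0.
have [c] := pmul_rinv x^i b0; rewrite dinvK => bc; exists b.
have := pmulA x x^i x a b c.
by rewrite bc ab dmulVx dmulxV pmulx1 pmul1x => ->.
Qed.

Lemma pmul_eq0 x y a b : pmul x y a b = 0 -> a = 0 \/ b = 0.
Proof.
move=> ab; have [->|a0] := eqVneq a 0; [by left|right].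
have [c ca] := pmul_linv x a0.
have := pmulA x^i x y c a b.
by rewrite ab pmulr0 ca dmulVx pmul1x.
Qed.

(** * The additive group of series with well-ordered support *)

Definition supp (f : G -> A) : set G := [set x | f x <> 0].

Lemma suppE f x : supp f x = (f x <> 0). Proof. by []. Qed.

Definition series : Type := {f : G -> A | well_ordered (supp f)}.

Definition mk_series (f : G -> A) (wf : well_ordered (supp f)) : series :=
  exist (fun h => well_ordered (supp h)) f wf.

Definition coef (f : series) : G -> A := sval f.
Coercion coef : series >-> Funclass.
Implicit Types f g h : series.

HB.instance Definition _ := gen_eqMixin series.
HB.instance Definition _ := gen_choiceMixin series.

Lemma series_ext f g : f =1 g -> f = g.
Proof.
case: f g => [f wf] [g wg] /= /funext fg; case: _ / fg in wg *.
by congr exist; exact: Prop_irrelevance.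
Qed.

Lemma suppP f : well_ordered (supp f). Proof. exact: (proj2_sig f). Qed.
Arguments suppP f : clear implicits.

Let zero_wo : well_ordered (supp (fun=> 0)).
Proof. by move=> P P0 [x /P0]; case. Qed.

Let add_wo f g : well_ordered (supp (fun x => f x + g x)).
Proof.
apply: (well_ordered_sub _ (well_orderedU (suppP f) (suppP g))) => x.
have [fx|fx] := pselect (f x = 0); last by left.
by rewrite /supp/= fx add0r; right.
Qed.

Let opp_wo f : well_ordered (supp (fun x => - f x)).
Proof.
apply: (well_ordered_sub _ (suppP f)) => x; rewrite /supp /= => nfx fx.
by apply: nfx; rewrite fx oppr0.
Qed.

Arguments add_wo : clear implicits.
Arguments opp_wo : clear implicits.

Definition zero_series : series := mk_series zero_wo.
Definition add_series f g : series := mk_series (add_wo f g).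
Definition opp_series f : series := mk_series (opp_wo f).

Let add_seriesA : associative add_series.
Proof. by move=> f g h; apply: series_ext => x /=; rewrite addrA. Qed.
Let add_seriesC : commutative add_series.
Proof. by move=> f g; apply: series_ext => x /=; rewrite addrC. Qed.
Let add_series0 : left_id zero_series add_series.
Proof. by move=> f; apply: series_ext => x /=; rewrite add0r. Qed.
Let add_seriesN : left_inverse zero_series opp_series add_series.
Proof. by move=> f; apply: series_ext => x /=; rewrite addNr. Qed.

HB.instance Definition _ := GRing.isZmodule.Build series
  add_seriesA add_seriesC add_series0 add_seriesN.

Lemma series_coefD f g x : coef (f + g) x = f x + g x. Proof. by []. Qed.
Lemma series_coef0 x : coef 0 x = 0. Proof. by []. Qed.
Lemma series_coefB f g x : coef (f - g) x = f x - g x. Proof. by []. Qed.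

Let mono_wo x a : well_ordered (supp (fun y => if y == x then a else 0)).
Proof. by apply: (well_ordered_sub _ (@well_ordered1 D x)) => y; rewrite /supp/=; case: eqP. Qed.

Arguments mono_wo : clear implicits.

Definition mono x a : series := mk_series (mono_wo x a).

Lemma coef_mono x a y : mono x a y = if y == x then a else 0.
Proof. by []. Qed.

(** * Convolution and the ring of series *)

Lemma fsum_seq (F : G -> A) (s : seq G) : uniq s -> (forall k, k \notin s -> F k = 0) ->
  \sum_(k \in [set: G]) F k = \sum_(k <- s) F k.
Proof.
move=> us F0; rewrite (@fsbigE _ _ _ _ _ s) //; last by move=> k _; exact: F0.
by apply: eq_bigl => k; rewrite in_setT.
Qed.

Lemma finite_set_seq (S : set G) : finite_set S ->
  exists2 s : seq G, uniq s & forall k, k \in s <-> S k.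
Proof.
move=> fS; exists (finmap.enum_fset (fset_set S)); first exact: finmap.fset_uniq.
by move=> k; rewrite in_fset_set// inE.
Qed.

(** The Cauchy product, indexed by the degree of the left factor, which determines that of the right
    one. The sum over all degrees takes the value 0 on an infinite support; for series this default
    never occurs, by [finite_factorizations]. *)
Definition conv (f g : G -> A) x := \sum_(k \in [set: G]) pmul k (k^i ** x) (f k) (g (k^i ** x)).

Lemma conv_seq (f g : G -> A) x (s : seq G) : uniq s ->
    (forall k, f k <> 0 -> g (k^i ** x) <> 0 -> k \in s) ->
  conv f g x = \sum_(k <- s) pmul k (k^i ** x) (f k) (g (k^i ** x)).
Proof.
move=> us fgs; apply: fsum_seq => // k; apply: contraNeq => nz; apply: fgs => e; move: nz;
  by rewrite e ?pmul0r ?pmulr0 eqxx.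
Qed.

Lemma conv_finite f g x : exists2 s : seq G, uniq s &
  forall k, k \in s <-> (f k <> 0 /\ g (k^i ** x) <> 0).
Proof. exact: finite_set_seq (finite_factorizations x (suppP f) (suppP g)). Qed.

Lemma conv_supp f g : supp (conv f g) `<=` dprod (supp f) (supp g).
Proof.
move=> x; apply: contra_notP => nx; rewrite /supp/= /conv fsbig1// => k _.
have [->|fk] := pselect (f k = 0); first by rewrite pmul0r.
have [->|gk] := pselect (g (k^i ** x) = 0); first by rewrite pmulr0.
by case: nx; exists k => //; exists (k^i ** x) => //; rewrite dmulKV.
Qed.

Let mul_wo f g : well_ordered (supp (conv f g)).
Proof.
apply: (well_ordered_sub (@conv_supp f g)); apply: well_ordered_prod; exact: suppP.
Qed.

Arguments mul_wo : clear implicits.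

Definition mul_series f g : series := mk_series (mul_wo f g).

Let mul_seriesDl : left_distributive mul_series add_series.
Proof.
move=> f g h; apply: series_ext => x /=.
have [s1 us1 s1P] := conv_finite f h x; have [s2 us2 s2P] := conv_finite g h x.
have us : uniq (undup (s1 ++ s2)) by exact: undup_uniq.
rewrite !(conv_seq us) => [|k u v|k u v|k u v]; rewrite ?mem_undup ?mem_cat.
- by rewrite -big_split; apply: eq_bigr => k _; rewrite pmulDl.
- by apply/orP; right; apply/s2P.
- by apply/orP; left; apply/s1P.
- have [fk|fk] := pselect (f k = 0); last by apply/orP; left; apply/s1P.
  by apply/orP; right; apply/s2P; split=> // gk; apply: u; rewrite /= fk gk addr0.
Qed.

Let mul_seriesDr : right_distributive mul_series add_series.
Proof.
move=> h f g; apply: series_ext => x /=.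
have [s1 us1 s1P] := conv_finite h f x; have [s2 us2 s2P] := conv_finite h g x.
have us : uniq (undup (s1 ++ s2)) by exact: undup_uniq.
rewrite !(conv_seq us) => [|k u v|k u v|k u v]; rewrite ?mem_undup ?mem_cat.
- by rewrite -big_split; apply: eq_bigr => k _; rewrite pmulDr.
- by apply/orP; right; apply/s2P.
- by apply/orP; left; apply/s1P.
- have [fk|fk] := pselect (f (k^i ** x) = 0); last by apply/orP; left; apply/s1P.
  by apply/orP; right; apply/s2P; split=> // gk; apply: v; rewrite /= fk gk addr0.
Qed.

(** Here [m] is [k] times the degree taken from [f]. This substitution gives the inner sum of a
    product bracketed to the right the index of the outer sum of the product bracketed to the
    left. *)
Lemma conv_shift (f g : G -> A) x k (s : seq G) : uniq s ->
    (forall m, f (k^i ** m) <> 0 -> g (m^i ** x) <> 0 -> m \in s) ->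
  conv f g (k^i ** x) =
    \sum_(m <- s) pmul (k^i ** m) (m^i ** x) (f (k^i ** m)) (g (m^i ** x)).
Proof.
move=> us fgs; have shiftK m : (k^i ** m)^i ** (k^i ** x) = m^i ** x.
  by rewrite dinvM dinvK -dmulA dmulKV.
rewrite (@conv_seq _ _ _ [seq k^i ** m | m <- s]).
- by rewrite big_map; apply: eq_bigr => m _; rewrite shiftK.
- by rewrite map_inj_uniq// => m n /(congr1 (dmul k)); rewrite !dmulKV.
- move=> l fl gl; apply/mapP; exists (k ** l); last by rewrite dmulVK.
  by apply: fgs; rewrite ?dmulVK// dinvM -dmulA.
Qed.

Let mul_seriesA : associative mul_series.
Proof.
move=> f g h; apply: series_ext => x /=.
have [K uK KP] : exists2 K : seq G, uniq K & forall k, k \in K <->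
    supp f k /\ dprod (supp g) (supp h) (k^i ** x).
  apply/finite_set_seq/finite_factorizations; first exact: suppP.
  by apply: well_ordered_prod; exact: suppP.
have [M uM MP] : exists2 M : seq G, uniq M & forall m, m \in M <->
    dprod (supp f) (supp g) m /\ supp h (m^i ** x).
  apply/finite_set_seq/finite_factorizations; last exact: suppP.
  by apply: well_ordered_prod; exact: suppP.
rewrite (conv_seq uK) => [|k fk ghk]; last by apply/KP; split=> //; exact: conv_supp.
rewrite (conv_seq uM) => [|m fgm hm]; last by apply/MP; split=> //; exact: conv_supp.
(* Both bracketings become one finite double sum: [k] is the degree taken from [f], and [m] the
   total degree taken from [f] and [g]. It remains to exchange the two summations. *)
transitivity (\sum_(k <- K) \sum_(m <- M)
    pmul m (m^i ** x) (pmul k (k^i ** m) (f k) (g (k^i ** m))) (h (m^i ** x))).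
  apply: eq_big_seq => k /KP [fk _].
  rewrite (@conv_shift g h x k M)// => [|m gm hm]; last first.
    by apply/MP; split=> //; exists k => //; exists (k^i ** m) => //; rewrite dmulKV.
  rewrite pmul_sumr; apply: eq_bigr => m _.
  have := pmulA k (k^i ** m) (m^i ** x) (f k) (g (k^i ** m)) (h (m^i ** x)).
  by rewrite -dmulA !dmulKV.
rewrite exchange_big; apply: eq_big_seq => m /MP [_ hm].
rewrite (conv_seq uK) => [|k fk gk]; first by rewrite pmul_suml.
apply/KP; split=> //; exists (k^i ** m) => //; exists (m^i ** x) => //.
by rewrite -dmulA dmulKV.
Qed.

Definition one_series := mono (done1 D) (pone D).

Lemma conv_monol x a f y : conv (mono x a) f (x ** y) = pmul x y a (f y).
Proof.
rewrite (@conv_seq _ _ _ [:: x])// => [|k]; last by rewrite coef_mono inE; case: eqP.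
by rewrite big_seq1 coef_mono eqxx dmulVK.
Qed.

Lemma conv_monor x a f y : conv f (mono x a) (y ** x) = pmul y x (f y) a.
Proof.
rewrite (@conv_seq _ _ _ [:: y])// => [|k _].
  by rewrite big_seq1 dmulVK coef_mono eqxx.
rewrite coef_mono inE; case: eqP => // e _; apply/eqP.
move/(congr1 (dmul k)): e; rewrite dmulKV => /(congr1 (fun z => z ** x^i)).
by rewrite -!dmulA dmulxV !dmulx1.
Qed.

Let mul_1series : left_id one_series mul_series.
Proof. by move=> f; apply: series_ext => x /=; rewrite -{1}[x]dmul1x conv_monol pmul1x. Qed.

Let mul_series1 : right_id one_series mul_series.
Proof. by move=> f; apply: series_ext => x /=; rewrite -{1}[x]dmulx1 conv_monor pmulx1. Qed.

Let one_series_neq0 : one_series != 0.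
Proof.
apply/eqP => /(congr1 (fun f : series => f (done1 D))).
by rewrite coef_mono eqxx series_coef0; apply/eqP; exact: pone_neq0.
Qed.

HB.instance Definition _ := GRing.Zmodule_isNzRing.Build series
  mul_seriesA mul_1series mul_series1 mul_seriesDl mul_seriesDr one_series_neq0.

Lemma series_coefM f g x : coef (f * g) x = conv f g x. Proof. by []. Qed.
(** By strict monotonicity on both sides, a nonzero term of the product has degree at least
    [x ** y], with equality only for the left degree [x]. The degrees [x] and [y] are mere lower
    bounds of the supports: the coefficients there may vanish, which the uniqueness and gluing
    arguments exploit. *)
Lemma lead_mul f g x y : (forall k, k <o x -> f k = 0) -> (forall k, k <o y -> g k = 0) ->
  coef (f * g) (x ** y) = pmul x y (f x) (g y) /\ forall z, z <o x ** y -> coef (f * g) z = 0.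
Proof.
move=> fx gy.
have low k z : f k <> 0 -> g (k^i ** z) <> 0 -> ~ z <o x ** y /\ (z = x ** y -> k = x).
  move=> fk gk; have nkx : ~ k <o x by move/fx.
  have nky : ~ k^i ** z <o y by move/gy.
  case: (dlt_nge nkx) => [e|xk].
    by split=> // /(dlt_mul2l k^i); rewrite -e dmulVK.
  have lt : x ** y <o z.
    rewrite -(dmulKV k z); case: (dlt_nge nky) => [->|yz]; first exact: dlt_mul2r.
    by apply: dlt_trans (dlt_mul2r y xk) _; exact: dlt_mul2l.
  by split=> [|e]; [exact: dlt_asym | case: (@dlt_irr D z); rewrite {1}e].
split=> [|z zxy]; rewrite series_coefM.
  rewrite (@conv_seq _ _ _ [:: x])// => [|k fk gk]; first by rewrite big_seq1 dmulVK.
  by rewrite inE; apply/eqP; apply: (low _ _ fk gk).2.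
rewrite (@conv_seq _ _ _ [::])// => [|k fk gk]; first by rewrite big_nil.
by case: (low _ _ fk gk).
Qed.

Lemma lead_exists f : f <> 0 -> exists x, least (supp f) x.
Proof.
move=> f0; apply: (suppP f) => //; apply: contrapT => nx; apply: f0.
apply: series_ext => x; apply: contrapT => fx; apply: nx; by exists x.
Qed.

Lemma least_supp f x : least (supp f) x -> forall k, k <o x -> f k = 0.
Proof. by case=> _ min k kx; apply: contrapT => fk; exact: (min k). Qed.

(** * Right inverses of series by gluing partial solutions *)

Section RightInverse.
Variables (f : series) (x : G).
Hypothesis lead_f : least (supp f) x.

(** The domain [C] is an initial segment of degrees for [g]. The equation is shifted by the lowest
    degree [x] of [f] because the coefficient of [f * g] at [x ** y] involves [g] only up to [y]. *)
Definition partial_inverse (C : set G) (g : series) :=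
  [/\ forall y z, C y -> z <o y -> C z,
      supp g `<=` C &
      forall y, C y -> coef (f * g) (x ** y) = coef 1 (x ** y)].

Let fx0 : f x <> 0. Proof. by case: lead_f. Qed.

(** At the least common degree [y] where the solutions differ, the coefficient of [f * (g - h)] at
    [x ** y] is a product of two nonzero components, yet both solutions satisfy the same equation
    there. *)
Lemma partial_inverse_unique C D' g h : partial_inverse C g -> partial_inverse D' h ->
  forall y, C y -> D' y -> g y = h y.
Proof.
move=> [Cdown _ gC] [Ddown _ hD] y0 Cy0 Dy0; apply: contrapT => gh.
have [y [[Cy [Dy ny]] miny]] : exists y, least [set y | C y /\ D' y /\ coef (g - h) y <> 0] y.
  apply: (suppP (g - h)) => [y [_ []]//|]; exists y0; do 2!split=> //.
  by move/eqP; rewrite series_coefB subr_eq0 => /eqP.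
have low k : k <o y -> coef (g - h) k = 0.
  move=> ky; apply: contrapT => nk; apply: (miny k) => //; split; first exact: Cdown ky.
  by split=> //; exact: Ddown ky.
have [e _] := lead_mul (least_supp lead_f) low.
have : coef (f * (g - h)) (x ** y) = 0 by rewrite mulrBr series_coefB gC// hD// subrr.
by rewrite e => /pmul_eq0 [/fx0|/ny].
Qed.

Definition solved y := exists C g, partial_inverse C g /\ C y.

(** Uniqueness makes partial solutions agree on overlapping domains. The glued support is
    well-ordered because up to any of its points it coincides with the support of a single partial
    solution. *)
Lemma glue_partial_inverses : exists g, partial_inverse solved g.
Proof.
have [g gP] : exists g : G -> A, forall y,
    (forall C h, partial_inverse C h -> C y -> g y = h y) /\ (~ solved y -> g y = 0).
  pose R y a := (forall C h, partial_inverse C h -> C y -> a = h y) /\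
    (~ solved y -> a = 0).
  have [y|g gR] := @choice _ _ R; last by exists g.
  have [[C [h [Ch Cy]]]|ns] := pselect (solved y).
    exists (h y); split=> [C' h' Ch' Cy'|[]]; last by exists C, h.
    exact: partial_inverse_unique Ch Ch' _ Cy Cy'.
  by exists 0; split=> // C h Ch Cy; case: ns; exists C, h.
have supp_g : supp g `<=` solved.
  by move=> y gy; apply: contrapT => /(gP y).2.
have wg : well_ordered (supp g).
  move=> P Pg [y Py]; have [C [h [Ch Cy]]] := supp_g y (Pg y Py).
  have [Cdown _ _] := Ch.
  have [m [[Pm nym] minm]] : exists m, least [set m | P m /\ ~ y <o m] m.
    apply: (suppP h) => [m [Pm nym]|]; last by exists y; split=> //; exact: dlt_irr.
    have Cm : C m by case: (dlt_nge nym) => [<-//|]; exact: Cdown.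
    by rewrite /supp /= -((gP m).1 C h)//; exact: Pg.
  exists m; split=> // z Pz zm; apply: (minm z) => //; split=> // yz.
  by apply: nym; exact: dlt_trans zm.
pose gs : series := mk_series wg.
exists gs; split=> [y z [C [h [Ch Cy]]] zy|//|y [C [h [Ch Cy]]]].
  by exists C, h; split=> //; case: Ch => Cdown _ _; exact: Cdown zy.
have [Cdown _ hC] := Ch; rewrite -hC//.
have agree z : z = y \/ z <o y -> coef (gs - h) z = 0.
  move=> zy; rewrite series_coefB; apply/eqP; rewrite subr_eq0; apply/eqP.
  by apply: (gP z).1 Ch _; case: zy => [->//|]; exact: Cdown.
have [e _] := lead_mul (least_supp lead_f) (fun k ky => agree k (or_intror ky)).
by apply/eqP; rewrite -subr_eq0 -series_coefB -mulrBr e agree ?pmulr0//; left.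
Qed.

(** If the glued solution left a nonzero remainder [r], its lowest degree would be [x ** y] with [y]
    unsolved. Adding one term in degree [y] removes this lowest coefficient, and so solves [y] after
    all. *)
Lemma exists_rinv_of_lead : exists g, f * g = 1.
Proof.
have [g [down supp_g gC]] := glue_partial_inverses; exists g.
apply: contrapT => fg; have /lead_exists [z [rz minz]] : 1 - f * g <> 0.
  by move/eqP; rewrite subr_eq0 => /eqP /esym.
set r := 1 - f * g in rz minz.
have [y ey] : exists y, z = x ** y by exists (x^i ** z); rewrite dmulKV.
have nsol : ~ solved y by move=> /gC gy; apply: rz; rewrite ey /r series_coefB gy subrr.
have [b fxb] := pmul_solve x y (coef r z) (introN eqP fx0).
(* The new domain consists of all degrees up to [y], and [b] is chosen so that the term of [f] in
   degree [x] times [b] is the lowest coefficient of the remainder. *)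
apply: (nsol); exists [set k | ~ y <o k], (g + mono y b); split; last exact: dlt_irr.
have above k : solved k -> k <o y.
  by case: (dlt_total k y) => // [->|yk sk]; [|have := down _ _ sk yk]; move=> ?; case: nsol.
split.
- by move=> k l nk lk yl; apply: nk; exact: dlt_trans lk.
- move=> k; rewrite suppE series_coefD coef_mono => + yk.
  have [e|_] := eqVneq k y; first by case: (@dlt_irr D y); rewrite -{2}e.
  have [->|gk] := pselect (g k = 0); first by rewrite addr0.
  by move=> _; apply: (dlt_asym yk); apply: above; exact: supp_g.
move=> k nyk; rewrite mulrDr series_coefD.
have mono_low l : l <o y -> mono y b l = 0.
  by rewrite coef_mono; case: eqP => // ->; move/dlt_irr.
have [ey' low] := lead_mul (least_supp lead_f) mono_low.
have -> : coef 1 (x ** k) = coef (f * g) (x ** k) + coef r (x ** k).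
  by rewrite /r series_coefB addrC subrK.
congr (_ + _); case: (dlt_nge nyk) => [<-|ky].
  by rewrite ey' coef_mono eqxx fxb ey.
rewrite low; last exact: dlt_mul2l.
apply/esym; apply: contrapT => rk; apply: (minz _ rk); rewrite ey; exact: dlt_mul2l.
Qed.
End RightInverse.

(** The condition [f <> 0] stands under the existential so that an inverse can be chosen for every
    [f] at once. A right inverse is two-sided because it has a right inverse itself. *)
Lemma series_inverse f : exists g, f <> 0 -> g * f = 1 /\ f * g = 1.
Proof.
have [->|f0] := eqVneq f 0; first by exists 0.
have rinv h : h <> 0 -> exists g, h * g = 1 by move=> /lead_exists [x]; exact: exists_rinv_of_lead.
have [g fg] := rinv f (elimN eqP f0).
exists g => _; split=> //.
have [h gh] : exists h, g * h = 1.
  by apply: rinv => g0; move/eqP: fg; rewrite g0 mulr0 eq_sym oner_eq0.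
by have -> : f = h by rewrite -[f]mulr1 -gh mulrA fg mul1r.
Qed.

Definition series_unit : pred series := fun f => f != 0.
Definition series_inv f : series :=
  if f == 0 then 0 else sval (cid (series_inverse f)).

Let series_mulVr : {in series_unit, left_inverse 1 series_inv *%R}.
Proof.
move=> f; rewrite unfold_in => f0; rewrite /series_inv (negbTE f0).
by case: cid => g /= /(_ (elimN eqP f0)) [].
Qed.

Let series_mulrV : {in series_unit, right_inverse 1 series_inv *%R}.
Proof.
move=> f; rewrite unfold_in => f0; rewrite /series_inv (negbTE f0).
by case: cid => g /= /(_ (elimN eqP f0)) [].
Qed.

Let series_unitP f g : g * f = 1 /\ f * g = 1 -> series_unit f.
Proof. by case=> gf _; apply/eqP => f0; move/eqP: gf; rewrite f0 mulr0 eq_sym oner_eq0. Qed.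

Let series_inv_out : {in [predC series_unit], series_inv =1 id}.
Proof. by move=> f; rewrite inE /= unfold_in negbK => /eqP ->; rewrite /series_inv eqxx. Qed.

HB.instance Definition _ := GRing.NzRing_hasMulInverse.Build series
  series_mulVr series_mulrV series_unitP series_inv_out.

Let series_neq0_unit f : f != 0 -> f \is a GRing.unit.
Proof. by []. Qed.

HB.instance Definition _ := isSkewField.Build series series_neq0_unit.

End GradedTheory.

(** * Quotients from lowest terms *)

Section Projection.
Variables (F : skewHyperfieldType) (K : skewFieldType) (pi : K -> F).
Hypothesis pi_eq0 : forall a, pi a = hzero <-> a = 0.
Hypothesis pi1 : pi 1 = hone.
Hypothesis piM : forall a b, pi (a * b) = hmul (pi a) (pi b).
Hypothesis pi_surj : forall x, exists a, pi a = x.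
Hypothesis pi_hadd : forall x y z,
  hadd x y z <-> exists a b, [/\ pi a = x, pi b = y & pi (a + b) = z].

Let U : set K := [set a | pi a = hone].

Let U_neq0 u : U u -> u != 0.
Proof.
rewrite /U /= => u1; apply/eqP => u0; apply: (@hzero_neq1 F).
by rewrite -u1; apply/esym/pi_eq0.
Qed.

Let pi_mulV u : u != 0 -> hmul (pi u) (pi u^-1) = hone.
Proof. by move=> /neq0_unit uu; rewrite -piM divrr. Qed.

Let pi_mulVl u : u != 0 -> hmul (pi u^-1) (pi u) = hone.
Proof. by move=> /neq0_unit uu; rewrite -piM mulVr. Qed.

Let UM u v : U u -> U v -> U (u * v).
Proof. by rewrite /U /= piM => -> ->; rewrite hmul1x. Qed.

Let UV u : U u -> U u^-1.
Proof. by move=> Uu; have := pi_mulV (U_neq0 Uu); rewrite /U /= Uu hmul1x. Qed.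

Let UJ g u : g != 0 -> U u -> U (g * u * g^-1).
Proof. by move=> g0; rewrite /U /= !piM => ->; rewrite hmulx1 pi_mulV. Qed.

Definition unit_fiber : normal_unit_subgroup K := NormalUnitSubgroup U_neq0 pi1 UM UV UJ.

Let class_eq a b : qclass unit_fiber a = qclass unit_fiber b <-> pi a = pi b.
Proof.
split=> [/qclass_eq [u /= Uu ->]|ab]; first by rewrite piM Uu hmulx1.
apply/qclass_eq; have [b0|b0] := eqVneq b 0.
  exists 1 => //=; rewrite b0 mul0r; apply/pi_eq0; rewrite ab b0; exact/pi_eq0.
exists (b^-1 * a); last by rewrite mulVKr//; exact: neq0_unit.
by rewrite /= /U /= piM ab pi_mulVl.
Qed.

(** By [class_eq] the fibres of [pi] are exactly the cosets of the fibre over 1, so the class of an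
    arbitrarily chosen preimage is well defined and determines its image. *)
Lemma projection_isomorphic : hyperfield_isomorphic F (quot unit_fiber).
Proof.
pose f x := qclass unit_fiber (sval (cid (pi_surj x))).
have fP x a : pi a = x -> f x = qclass unit_fiber a.
  by move=> e; apply/class_eq; rewrite e; case: cid.
have f_surj A : exists x, f x = A.
  by have [a ->] := qclass_surj A; exists (pi a); exact: fP.
have f_inj : injective f.
  move=> x y; have [[a ax] [b yb]] := (pi_surj x, pi_surj y).
  by rewrite (fP _ _ ax) (fP _ _ yb) => /class_eq; rewrite ax yb.
exists f; split.
- exists (fun A => sval (cid (f_surj A))) => [x|A]; last by case: cid.
  by apply: f_inj; case: cid.
- by apply: fP; apply/pi_eq0.
- exact: fP.
- move=> x y; have [[a ax] [b yb]] := (pi_surj x, pi_surj y).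
  by rewrite (fP _ _ ax) (fP _ _ yb) [RHS]qmulE; apply: fP; rewrite piM ax yb.
move=> x y; apply/seteqP; split=> [_ [z /pi_hadd [a [b [ax yb abz]]] <-]|C].
  by apply/qaddP; exists a, b; split; exact: fP.
move=> /qaddP [a [b [fa fb ->]]]; exists (pi (a + b)); last exact: fP.
apply/pi_hadd; exists a, b; split=> //; apply: f_inj.
  by rewrite fa; exact: fP.
by rewrite fb; exact: fP.
Qed.

End Projection.

(* [lead x a] is the element of [F] represented by all series with lowest term
   [a] in degree [x]. *)
Record leading_map (D : graded_division_ring) (F : skewHyperfieldType) := LeadingMap {
  lead :> deg D -> part D -> F;
  lead_eq0 : forall x a, lead x a = hzero <-> a = 0;
  lead1 : lead (done1 D) (pone D) = hone;
  leadM : forall x y a b, lead (dmul x y) (pmul x y a b) = hmul (lead x a) (lead y b);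
  lead_surj : forall u, u <> hzero -> exists x a, lead x a = u;
  leadD : forall x a b, hadd (lead x a) (lead x b) (lead x (a + b));
  lead_dominant : forall x y a b, dlt x y -> a <> 0 ->
    hadd (lead x a) (lead y b) (lead x a);
  lead_cancel : forall x y a b, dlt x y -> a <> 0 ->
    hadd (lead x a) (lead x (- a)) (lead y b);
  lead_hadd : forall u v w, u <> hzero -> v <> hzero -> hadd u v w ->
    [\/ exists x a b, [/\ u = lead x a, v = lead x b & w = lead x (a + b)],
        exists x y a b, [/\ dlt x y, u = lead x a, v = lead y b & w = u],
        exists x y a b, [/\ dlt x y, v = lead x a, u = lead y b & w = v] |
        exists x y a b, [/\ dlt x y, u = lead x a, v = lead x (- a) & w = lead y b]]
}.

(** * The lowest term of a series as a projection onto [F] *)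

Section LeadingMap.
Variables (D : graded_division_ring) (F : skewHyperfieldType) (p : leading_map D F).
Local Notation "x <o y" := (dlt x y) (at level 70).
Implicit Types (f g : series D) (x y : deg D).

Definition leading_term f : F :=
  if pselect (f <> 0) is left f0 then
    let x := sval (cid (lead_exists f0)) in p x (f x)
  else hzero.

Lemma leading_term0 : leading_term 0 = hzero.
Proof. by rewrite /leading_term; case: pselect. Qed.

Lemma leading_termE f x : (forall k, k <o x -> f k = 0) -> f x <> 0 -> leading_term f = p x (f x).
Proof.
move=> low fx; rewrite /leading_term; case: pselect => [f0|nf0] /=; last first.
  by case: nf0 => f0; apply: fx; rewrite f0 series_coef0.
case: cid => y /= [fy miny]; suff -> : y = x by [].
by case: (dlt_total x y) => // [xy|yx]; [case: (miny x) | case: fy; exact: low].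
Qed.

Lemma leading_term_least f x : least (supp f) x -> leading_term f = p x (f x).
Proof. by move=> lx; apply: leading_termE; [exact: least_supp | exact: lx.1]. Qed.

Lemma mono_low x a k : k <o x -> mono x a k = 0.
Proof. by rewrite coef_mono; case: eqP => // -> /dlt_irr. Qed.

Lemma mono_diag x a : mono x a x = a.
Proof. by rewrite coef_mono eqxx. Qed.

Lemma mono_eq0 x : mono x 0 = 0.
Proof. by apply: series_ext => y; rewrite coef_mono; case: eqP. Qed.

Lemma mono_add x a b : mono x a + mono x b = mono x (a + b).
Proof.
apply: series_ext => y; rewrite series_coefD !coef_mono.
by case: eqP => // _; rewrite addr0.
Qed.

Lemma leading_term_mono x a : leading_term (mono x a) = p x a.
Proof.
have [->|a0] := pselect (a = 0).
  by rewrite mono_eq0 leading_term0; apply/esym/lead_eq0.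
by rewrite (@leading_termE _ x) ?mono_diag//; exact: mono_low.
Qed.

Lemma leading_term_eq0 f : leading_term f = hzero <-> f = 0.
Proof.
split=> [|->]; last exact: leading_term0.
apply: contraPP => /lead_exists [x lx]; rewrite (leading_term_least lx).
by case: lx => fx _ /lead_eq0.
Qed.

Lemma leading_termM f g : leading_term (f * g) = hmul (leading_term f) (leading_term g).
Proof.
have [->|/lead_exists [x lx]] := pselect (f = 0).
  by rewrite mul0r leading_term0 hmul0x.
have [->|/lead_exists [y ly]] := pselect (g = 0).
  by rewrite mulr0 leading_term0 hmulx0.
have [e low] := lead_mul (least_supp lx) (least_supp ly).
rewrite (leading_term_least lx) (leading_term_least ly) (leading_termE low) ?e ?leadM//.
by case: lx ly => fx _ [gy _] /pmul_eq0 [].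
Qed.

Lemma leading_term_surj u : exists f, leading_term f = u.
Proof.
have [->|/(lead_surj p) [x [a <-]]] := pselect (u = hzero).
  by exists 0; exact: leading_term0.
by exists (mono x a); exact: leading_term_mono.
Qed.

Lemma leading_term_add_dominant f g x y : least (supp f) x -> least (supp g) y ->
  x <o y -> leading_term (f + g) = leading_term f.
Proof.
move=> lx ly xy; have gx := least_supp ly xy.
rewrite (leading_term_least lx) (@leading_termE _ x) ?series_coefD ?gx ?addr0//; last exact: lx.1.
move=> k kx; rewrite series_coefD (least_supp lx kx) (least_supp ly) ?addr0//.
exact: dlt_trans xy.
Qed.

Lemma leading_term_add f g :
  hadd (leading_term f) (leading_term g) (leading_term (f + g)).
Proof.
have [->|/lead_exists [x lx]] := pselect (f = 0).
  by rewrite add0r leading_term0 hadd0x.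
have [->|/lead_exists [y ly]] := pselect (g = 0).
  by rewrite addr0 leading_term0 haddx0.
case: (dlt_total x y) => [xy|exy|yx].
- rewrite (leading_term_add_dominant lx ly xy).
  rewrite (leading_term_least lx) (leading_term_least ly).
  by apply: lead_dominant => //; exact: lx.1.
- rewrite -exy in ly.
  rewrite (leading_term_least lx) (leading_term_least ly).
  have low k : k <o x -> coef (f + g) k = 0.
    by move=> kx; rewrite series_coefD (least_supp lx kx) (least_supp ly kx) addr0.
  have [fgx|fgx] := pselect (coef (f + g) x = 0); last first.
    by rewrite (leading_termE low fgx); exact: leadD.
  have egx : g x = - f x by apply/eqP; rewrite -addr_eq0 addrC; apply/eqP.
  rewrite egx; have [->|/lead_exists [z lz]] := pselect (f + g = 0).
    rewrite leading_term0; have := leadD p x (f x) (- f x).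
    by rewrite subrr (proj2 (lead_eq0 p x 0)).
  (* The two lowest terms have cancelled, so what remains of [f + g] starts in a degree [z] strictly
     above [x]. *)
  rewrite (leading_term_least lz); apply: lead_cancel; last exact: lx.1.
  case: (dlt_total x z) => // [exz|zx]; case: lz => fgz _; first by case: fgz; rewrite -exz.
  by case: fgz; exact: low.
- rewrite haddC addrC (leading_term_add_dominant ly lx yx).
  rewrite (leading_term_least lx) (leading_term_least ly).
  by apply: lead_dominant => //; exact: ly.1.
Qed.

Lemma leading_term_mono_dominant x y a b : x <o y -> a <> 0 ->
  leading_term (mono x a + mono y b) = p x a.
Proof.
move=> xy a0; rewrite (@leading_termE _ x) ?series_coefD ?mono_diag ?(mono_low _ xy) ?addr0//.
by move=> k kx; rewrite series_coefD !mono_low ?addr0//; exact: dlt_trans xy.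
Qed.

(** Every value of a hypersum is realised by explicit series: the four cases of [lead_hadd] need
    only monomials, except that cancellation needs a binomial. *)
Lemma leading_term_hadd u v w : hadd u v w <->
  exists f g, [/\ leading_term f = u, leading_term g = v & leading_term (f + g) = w].
Proof.
split=> [|[f [g [<- <- <-]]]]; last exact: leading_term_add.
have [->|u0] := pselect (u = hzero).
  have [f <-] := leading_term_surj v; rewrite hadd0x => ->.
  by exists 0, f; rewrite leading_term0 add0r.
have [->|v0] := pselect (v = hzero).
  have [f <-] := leading_term_surj u; rewrite haddx0 => ->.
  by exists f, 0; rewrite leading_term0 addr0.
have neq0 x a : p x a <> hzero -> a <> 0 by move=> pa a0; apply: pa; exact/lead_eq0.
move=> /(lead_hadd p u0 v0) [].
- move=> [x [a [b [-> -> ->]]]]; exists (mono x a), (mono x b).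
  by rewrite mono_add !leading_term_mono.
- move=> [x [y [a [b [xy ua vb ->]]]]]; exists (mono x a), (mono y b).
  by rewrite leading_term_mono_dominant ?leading_term_mono//; apply: (neq0 x); rewrite -ua.
- move=> [x [y [a [b [xy va ub ->]]]]]; exists (mono y b), (mono x a).
  by rewrite addrC leading_term_mono_dominant ?leading_term_mono//; apply: (neq0 x); rewrite -va.
(* The term in degree [y] is hidden behind [- a] in the second series and surfaces once [a]
   cancels. *)
- move=> [x [y [a [b [xy ua va ->]]]]]; exists (mono x a), (mono x (- a) + mono y b).
  rewrite addrA mono_add subrr mono_eq0 add0r leading_term_mono_dominant//.
    by rewrite !leading_term_mono.
  by apply: (neq0 x); rewrite -va.
Qed.

Lemma leading_map_quotient :
  exists (K : skewFieldType) (U : normal_unit_subgroup K), hyperfield_isomorphic F (quot U).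
Proof.
have lt1 : leading_term 1 = hone by rewrite (leading_term_mono (done1 D) (pone D)) lead1.
exists (series D); eexists.
exact: (@projection_isomorphic _ _ _ leading_term_eq0 lt1 leading_termM
  leading_term_surj leading_term_hadd).
Qed.

End LeadingMap.

(** * Doubly distributive skew hyperfields *)

Section HyperfieldTheory.
Variable F : skewHyperfieldType.
Local Notation "x ** y" := (hmul x y) (at level 40, left associativity).
Implicit Types x y z u v w a b c : F.

Definition hinv x : F :=
  if pselect (x <> hzero) is left nx then sval (cid (hinv_exists x nx)) else hzero.
Local Notation "x ^i" := (hinv x) (at level 3, format "x ^i").

Lemma hmulxV x : x <> hzero -> x ** x^i = hone.
Proof. by move=> nx; rewrite /hinv; case: pselect => // nx'; case: cid => y []. Qed.

Lemma hmulVx x : x <> hzero -> x^i ** x = hone.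
Proof. by move=> nx; rewrite /hinv; case: pselect => // nx'; case: cid => y []. Qed.

Lemma hmulKV x y : x <> hzero -> x ** (x^i ** y) = y.
Proof. by move=> nx; rewrite hmulA hmulxV// hmul1x. Qed.

Lemma hmulVK x y : x <> hzero -> x^i ** (x ** y) = y.
Proof. by move=> nx; rewrite hmulA hmulVx// hmul1x. Qed.

Lemma hmulxK x y : x <> hzero -> y ** x ** x^i = y.
Proof. by move=> nx; rewrite -hmulA hmulxV// hmulx1. Qed.

Lemma hmul_neq0 x y : x <> hzero -> y <> hzero -> x ** y <> hzero.
Proof. by move=> nx ny xy; apply: ny; rewrite -(hmulVK y nx) xy hmulx0. Qed.

Lemma hone_neq0 : hone <> hzero :> F.
Proof. by move/esym; exact: hzero_neq1. Qed.

Lemma hinv_neq0 x : x <> hzero -> x^i <> hzero.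
Proof. by move=> nx e; apply: hone_neq0; rewrite -(hmulxV nx) e hmulx0. Qed.

Lemma hmul_inj x y z : x <> hzero -> x ** y = x ** z -> y = z.
Proof. by move=> nx e; rewrite -(hmulVK y nx) e hmulVK. Qed.

Lemma hinvM x y : x <> hzero -> y <> hzero -> (x ** y)^i = y^i ** x^i.
Proof.
move=> nx ny; have nxy := hmul_neq0 nx ny.
by apply: (hmul_inj nxy); rewrite hmulxV// hmulA hmulxK// hmulxV.
Qed.

Lemma hinvK x : x <> hzero -> x^i^i = x.
Proof.
move=> nx; have nV := hinv_neq0 nx.
by apply: (hmul_inj nV); rewrite hmulxV// hmulVx.
Qed.

Lemma hinv1 : hone^i = hone :> F.
Proof. by rewrite -[LHS]hmul1x hmulxV//; exact: hone_neq0. Qed.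

Lemma hadd_opp x : hadd x (hopp x) hzero.
Proof. exact/hadd_rinv. Qed.

Lemma hoppK x : hopp (hopp x) = x.
Proof. by apply/esym/hadd_linv; exact: hadd_opp. Qed.

Lemma hadd_mull a x y z : hadd x y z -> hadd (a ** x) (a ** y) (a ** z).
Proof. by move=> xyz; rewrite -hmulDr; exists z. Qed.

Lemma hadd_mulr a x y z : hadd x y z -> hadd (x ** a) (y ** a) (z ** a).
Proof. by move=> xyz; rewrite -hmulDl; exists z. Qed.

Lemma hmulNr x y : x ** hopp y = hopp (x ** y).
Proof.
by apply/hadd_rinv; have := hadd_mull x (hadd_opp y); rewrite hmulx0.
Qed.

Lemma hmulNl x y : hopp x ** y = hopp (x ** y).
Proof.
by apply/hadd_rinv; have := hadd_mulr y (hadd_opp x); rewrite hmul0x.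
Qed.

Lemma hopp0 : hopp hzero = hzero :> F.
Proof. by rewrite -[in LHS](hmulx0 hone) -hmulNl hmulx0. Qed.

Lemma hopp_neq0 x : x <> hzero -> hopp x <> hzero.
Proof. by move=> nx e; apply: nx; rewrite -[x]hoppK e hopp0. Qed.

Lemma haddNN x y z : hadd x y z -> hadd (hopp x) (hopp y) (hopp z).
Proof. by rewrite haddC => /hadd_rev. Qed.

Lemma hadd_comm x y z : hadd x y z -> hadd y x z.
Proof. by rewrite haddC. Qed.

Lemma hadd_assocr x y z u w : hadd x y u -> hadd u z w ->
  exists2 v, hadd y z v & hadd x v w.
Proof.
move=> xyu uzw; have : hyper_lift hadd (hadd x y) [set z] w by exists u => //; exists z.
by rewrite -haddA => -[_ -> [v yzv xvw]]; exists v.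
Qed.

Lemma hadd_assocl x y z v w : hadd y z v -> hadd x v w ->
  exists2 u, hadd x y u & hadd u z w.
Proof.
move=> yzv xvw; have : hyper_lift hadd [set x] (hadd y z) w by exists x => //; exists v.
by rewrite haddA => -[u xyu [_ -> uzw]]; exists u.
Qed.

Lemma hadd_subr x y z : hadd x y z -> hadd z (hopp y) x.
Proof.
move=> xyz; have [v yzv /hadd_rinv ev] := hadd_assocr xyz (hadd_opp z).
by move: yzv; rewrite ev => /hadd_rev; rewrite !hoppK.
Qed.

Lemma hadd_same_diff x m : hadd x m x <-> hadd x (hopp x) m.
Proof.
split=> [/hadd_comm/hadd_subr //|/hadd_subr]; by rewrite hoppK => /hadd_comm.
Qed.

(** * Singleton sums and the set [M = 1 - 1] *)

Section DoublyDistributive.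
Hypothesis hF : doubly_distributive F.

Lemma stringent a b x y : b <> hopp a -> hadd a b x -> hadd a b y -> x = y.
Proof.
(* [0] lies in [(a + b)(x^-1 - y^-1)], which contains [x x^-1 - y y^-1]. *)
move=> nab abx aby.
have n0 z : hadd a b z -> z <> hzero by move=> + z0; rewrite z0 => /hadd_rinv.
have [nx ny] := (n0 x abx, n0 y aby).
have sx := hadd_mulr x^i abx; rewrite hmulxV// in sx.
have sy := hadd_mulr (hopp y^i) aby; rewrite (hmulNr y) hmulxV// in sy.
have [t st tbd] := hadd_assocl sy (hadd_opp hone).
have [t' t1 t2] := hadd_assocr sx st.
have [t'' t3 t4] := hadd_assocl (hadd_comm t1) t2.
have : [set u ** v | u in hadd a b & v in hadd x^i (hopp y^i)] hzero.
  rewrite hF; exists t; last by exists (b ** hopp y^i).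
  by exists t'' => //; exists (b ** x^i).
(* No element of [a + b] is zero, so the factor from [x^-1 - y^-1] must be; hence the two inverses
   coincide. *)
case=> u abu [v xyv uv0]; have v0 : v = hzero.
  by apply: contrapT => nv; apply: (hmul_neq0 (n0 u abu) nv).
move: xyv; rewrite v0 => /hadd_rinv /(congr1 hopp); rewrite !hoppK => e.
by rewrite -[x]hinvK// -e hinvK.
Qed.

(* The valuation ring of the natural valuation on [F] if [1] is in [M], and its
   maximal ideal otherwise. *)
Definition M : set F := hadd hone (hopp hone).

Lemma M_absorbed x : M x <-> hadd hone x hone.
Proof. by split=> /hadd_same_diff. Qed.

Lemma M0 : M hzero.
Proof. exact: hadd_opp. Qed.

Lemma MN x : M x -> M (hopp x).
Proof. by move=> /hadd_rev; rewrite hoppK. Qed.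

(** Adding [x] and then [y] to 1 can return 1, so 1 absorbs some element of [x + y]. Unless
    [y = -x], that element is [z] by [stringent]. *)
Lemma MD x y z : M x -> M y -> hadd x y z -> M z.
Proof.
move=> Mx My xyz; have [xy|nxy] := pselect (y = hopp x); last first.
  move/M_absorbed: My => /(hadd_assocr (proj1 (M_absorbed x) Mx)) [v xyv].
  by rewrite (stringent nxy xyz xyv) => /M_absorbed.
have [x1|nx1] := pselect (x = hone); first by rewrite -/M x1 xy x1 in xyz.
have xzx : hadd x z x by apply/hadd_same_diff; rewrite -xy.
(* Now [x] absorbs [z] and 1 absorbs [x], which yields [w] in [1 + z] with 1 in [w + x]. Both [w]
   and 1 lie in [1 - x], a singleton because [x] is not 1. *)
have [w zw wx] := hadd_assocl (hadd_comm xzx) (proj1 (M_absorbed x) Mx).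
apply/M_absorbed; suff e : w = hone by rewrite e in zw.
apply: (@stringent hone (hopp x)); last 2 first.
- exact: hadd_subr.
- by apply/M_absorbed; exact: MN.
by move=> /(congr1 hopp); rewrite !hoppK.
Qed.

(** Double distributivity turns [(1 - 1)(1 - 1)] into [1 - 1 - 1 + 1], which is a sum of two copies
    of [M]. *)
Lemma MM x y : M x -> M y -> M (x ** y).
Proof.
move=> Mx My.
have : [set u ** v | u in M & v in M] (x ** y) by exists x => //; exists y.
rewrite /M hF hmul1x hmulx1 hmul1x hmulNl hmulNr hmulx1 hoppK.
move=> [u [v Mv [_ -> vu]] [_ -> uxy]].
have [t /hadd_comm Mt vt] := hadd_assocr vu uxy.
exact: MD Mv Mt vt.
Qed.

Lemma M_conj a m : a <> hzero -> M m -> M (a ** m ** a^i).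
Proof.
move=> na /(hadd_mull a)/(hadd_mulr a^i).
by rewrite hmulx1 hmulNr hmulNl hmulx1 hmulxV.
Qed.

Lemma M_scale x m : x <> hzero -> hadd x (hopp x) m <-> M (x^i ** m).
Proof.
move=> nx; split=> [/(hadd_mull x^i)|/(hadd_mull x)].
  by rewrite hmulNr hmulVx.
by rewrite hmulNr hmulx1 hmulKV.
Qed.

(** The claim amounts to [x] absorbing [m]. For [w] in [1 + x], both [x] and the sum of [x] and [m]
    lie in [w - 1], since 1 absorbs [m]. This is a singleton: [w] is not 1 because [x] is not in
    [M]. *)
Lemma M_total x m : x <> hzero -> ~ M x -> M m -> M (x^i ** m).
Proof.
move=> nx nMx Mm; apply/(M_scale _ nx); apply/hadd_same_diff.
have nmx : m <> hopp x by move=> e; apply: nMx; rewrite -[x]hoppK -e; exact: MN.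
have [u xmu] := hadd_nonempty x m; suff e : u = x by rewrite e in xmu.
have [w xw] := hadd_nonempty hone x.
have [v mxv vw] := hadd_assocr (proj1 (M_absorbed m) Mm) xw.
rewrite (stringent nmx (hadd_comm mxv) xmu) in vw.
apply: (@stringent w (hopp hone)).
- by move/(congr1 hopp); rewrite !hoppK => w1; apply: nMx; apply/M_absorbed; rewrite -w1 in xw.
- by apply: hadd_subr; exact: hadd_comm.
- by apply: hadd_subr; exact: hadd_comm.
Qed.

(** The multipliers of [M] form the valuation ring in both cases; if 1 is in [M], they are [M]
    itself. *)
Definition absorbs z := forall m, M m -> M (z ** m).

Lemma absorbs1 : absorbs hone.
Proof. by move=> m; rewrite hmul1x. Qed.

Lemma absorbsN z : absorbs z -> absorbs (hopp z).
Proof. by move=> az m /az /MN; rewrite hmulNl. Qed.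

Lemma absorbsM y z : absorbs y -> absorbs z -> absorbs (y ** z).
Proof. by move=> ay az m Mm; rewrite -hmulA; apply/ay/az. Qed.

Lemma absorbs_M z : M z -> absorbs z.
Proof. by move=> Mz m; exact: MM. Qed.

Lemma absorbs_nM z : z <> hzero -> ~ M z -> absorbs z^i.
Proof. by move=> nz nMz m; exact: M_total. Qed.

(** Invariance under conjugation is what later makes the order on levels compatible with
    multiplication on the right as well as on the left. *)
Lemma absorbs_conj a z : a <> hzero -> absorbs z -> absorbs (a ** z ** a^i).
Proof.
move=> na az m Mm; have nV := hinv_neq0 na.
have /az/(M_conj na) : M (a^i ** m ** a) by have := M_conj nV Mm; rewrite hinvK.
by rewrite !hmulA hmulxK.
Qed.

(* [x] dominates [y] if [yM] is strictly contained in [xM]. *)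
Definition dominates x y := ~ absorbs (y^i ** x).

Definition same_level x y := absorbs (x^i ** y) /\ absorbs (y^i ** x).

Lemma dominates_M x y : x <> hzero -> y <> hzero -> dominates x y -> M (x^i ** y).
Proof.
move=> nx ny dxy; apply: contrapT => nM; apply: dxy.
have nV := hinv_neq0 nx.
by have := absorbs_nM (hmul_neq0 nV ny) nM; rewrite hinvM// hinvK.
Qed.

Lemma dominates_hadd x y : x <> hzero -> y <> hzero -> dominates x y -> hadd x y x.
Proof.
by move=> nx ny /(dominates_M nx ny) /(M_scale _ nx); exact: (hadd_same_diff _ _).2.
Qed.

Lemma dominates_irr x : x <> hzero -> ~ dominates x x.
Proof. by move=> nx; apply; rewrite hmulVx//; exact: absorbs1. Qed.

Lemma dominatesN x y : y = hopp x -> x <> hzero -> ~ dominates x y.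
Proof.
move=> -> nx; apply; have nN := hopp_neq0 nx.
suff -> : (hopp x)^i ** x = hopp hone by apply: absorbsN absorbs1.
by apply: (hmul_inj nN); rewrite hmulKV// hmulNr hmulx1 hoppK.
Qed.

Lemma dominates_hadd_unique x y w : x <> hzero -> y <> hzero -> dominates x y ->
  hadd x y w -> w = x.
Proof.
move=> nx ny d xyw; apply: stringent xyw (dominates_hadd nx ny d) => e.
exact: dominatesN e nx d.
Qed.

Lemma dominates_trans y x z : x <> hzero -> y <> hzero -> z <> hzero ->
  dominates x y -> dominates y z -> dominates x z.
Proof.
move=> nx ny nz dxy dyz azx; apply: dxy.
rewrite -[x](hmulKV x nz) hmulA; apply: absorbsM => //.
by apply: absorbs_M; exact: dominates_M.
Qed.

(** * Levels as an equivalence relation, their comparison, and compatibility with products *)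

Lemma same_level_refl x : x <> hzero -> same_level x x.
Proof. by move=> nx; split; rewrite hmulVx//; exact: absorbs1. Qed.

Lemma same_level_sym x y : same_level x y -> same_level y x.
Proof. by case. Qed.

Lemma same_level_trans y x z : y <> hzero -> same_level x y -> same_level y z -> same_level x z.
Proof.
move=> ny [xy yx] [yz zy]; split.
  by rewrite -[z](hmulKV z ny) hmulA; exact: absorbsM.
by rewrite -[x](hmulKV x ny) hmulA; exact: absorbsM.
Qed.

Lemma level_trichotomy x y : x <> hzero -> y <> hzero ->
  [\/ dominates x y, same_level x y | dominates y x].
Proof.
move=> nx ny; rewrite /dominates /same_level.
have [] := pselect (absorbs (x^i ** y)); have [] := pselect (absorbs (y^i ** x)) => ? ?;
  by [apply: Or32|apply: Or31|apply: Or33].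
Qed.

Lemma hquot_mull a x y : a <> hzero -> x <> hzero -> (a ** x)^i ** (a ** y) = x^i ** y.
Proof. by move=> na nx; rewrite hinvM// -hmulA hmulVK. Qed.

Lemma hquot_mulr a x y : a <> hzero -> x <> hzero ->
  (x ** a)^i ** (y ** a) = a^i ** (x^i ** y) ** a^i^i.
Proof. by move=> na nx; rewrite hinvM// hinvK// !hmulA. Qed.

Lemma absorbs_conjV a z : a <> hzero -> absorbs (a^i ** z ** a^i^i) = absorbs z.
Proof.
move=> na; apply/propext; split=> [/(absorbs_conj na)|]; last exact/absorbs_conj/hinv_neq0.
by rewrite hinvK// !hmulA hmulxV// hmul1x hmulxK.
Qed.

Lemma dominates_mull a x y : a <> hzero -> y <> hzero ->
  dominates (a ** x) (a ** y) <-> dominates x y.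
Proof. by move=> na ny; rewrite /dominates hquot_mull. Qed.

Lemma dominates_mulr a x y : a <> hzero -> y <> hzero ->
  dominates (x ** a) (y ** a) <-> dominates x y.
Proof. by move=> na ny; rewrite /dominates hquot_mulr// absorbs_conjV. Qed.

Lemma same_level_mull a x y : a <> hzero -> x <> hzero -> y <> hzero ->
  same_level (a ** x) (a ** y) <-> same_level x y.
Proof. by move=> na nx ny; rewrite /same_level !hquot_mull. Qed.

Lemma same_level_mulr a x y : a <> hzero -> x <> hzero -> y <> hzero ->
  same_level (x ** a) (y ** a) <-> same_level x y.
Proof. by move=> na nx ny; rewrite /same_level !hquot_mulr// !absorbs_conjV. Qed.

Lemma same_levelM x y u v : x <> hzero -> y <> hzero -> u <> hzero -> v <> hzero ->
  same_level x u -> same_level y v -> same_level (x ** y) (u ** v).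
Proof.
move=> nx ny nu nv xu yv; apply: (@same_level_trans (u ** y)); first exact: hmul_neq0.
  exact/same_level_mulr.
exact/same_level_mull.
Qed.

Lemma same_levelV x y : x <> hzero -> y <> hzero -> same_level x y ->
  same_level x^i y^i.
Proof.
move=> nx ny [xy yx]; split; rewrite hinvK//.
  by have := absorbs_conj ny yx; rewrite hmulKV.
by have := absorbs_conj nx xy; rewrite hmulKV.
Qed.

Lemma dominates_level x y x' y' : x <> hzero -> y <> hzero -> x' <> hzero -> y' <> hzero ->
  same_level x x' -> same_level y y' -> dominates x y -> dominates x' y'.
Proof.
move=> nx ny nx' ny' [_ xx'] [yy' _] dxy axy; apply: dxy.
have yx' : absorbs (y^i ** x').
  by rewrite -[x'](hmulKV x' ny') hmulA; exact: absorbsM.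
by rewrite -[x](hmulKV x nx') hmulA; exact: absorbsM.
Qed.

End DoublyDistributive.
End HyperfieldTheory.

(** * The group of levels *)

Section Degrees.
Variable F : skewHyperfieldType.
Local Notation "x ** y" := (hmul x y) (at level 40, left associativity).
Local Notation "x ^i" := (hinv x) (at level 3, format "x ^i").
Implicit Types x y z u v w : F.

(** The level of 1 is forced to be represented by 1 itself; this makes 1 an exact identity for the
    products of components in the encoding by representatives. *)
Definition level_rep x : F :=
  if pselect (same_level x hone) then hone
  else xget (hone : {classic F}) [set y | y <> hzero /\ same_level x y].

(* The degrees are the chosen representatives of the levels. *)
Definition degree : Type := {x : F | x <> hzero /\ level_rep x = x}.

HB.instance Definition _ := gen_eqMixin degree.
HB.instance Definition _ := gen_choiceMixin degree.

Definition rep (g : degree) : F := sval g.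
Implicit Types g h k : degree.

Hypothesis hF : doubly_distributive F.

Lemma level_repP x : x <> hzero -> level_rep x <> hzero /\ same_level x (level_rep x).
Proof.
move=> nx; rewrite /level_rep; case: pselect => [x1|nx1]; first by split=> //; exact: hone_neq0.
apply: (@xgetPex {classic F} hone [set y | y <> hzero /\ same_level x y]).
by exists x; split=> //; exact: same_level_refl.
Qed.

Lemma level_rep_eq x y : x <> hzero -> y <> hzero -> same_level x y -> level_rep x = level_rep y.
Proof.
move=> nx ny xy; have e z : same_level x z = same_level y z.
  apply/propext; split; apply: same_level_trans => //.
  exact: same_level_sym.
rewrite /level_rep e; case: pselect => // nx1.
by congr (@xget {classic F} _ _); apply/funext => z /=; rewrite e.
Qed.

Lemma level_rep_id x : x <> hzero -> level_rep (level_rep x) = level_rep x.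
Proof.
by move=> nx; have [nr xr] := level_repP nx; apply/esym/level_rep_eq.
Qed.

Lemma level_rep1 : level_rep hone = hone.
Proof.
rewrite /level_rep; case: pselect => //; case.
by apply: same_level_refl; exact: hone_neq0.
Qed.

Definition degree1 : degree := exist _ hone (conj (@hone_neq0 F) level_rep1).

Definition level x : degree :=
  if pselect (x <> hzero) is left nx
  then exist _ (level_rep x) (conj (proj1 (level_repP nx)) (level_rep_id nx))
  else degree1.

Lemma rep_inj g h : rep g = rep h -> g = h.
Proof.
case: g h => [x px] [y py] /= xy; case: _ / xy in py *.
by congr exist; exact: Prop_irrelevance.
Qed.

Lemma rep_neq0 g : rep g <> hzero.
Proof. by case: g => x []. Qed.

Lemma rep_level x : x <> hzero -> rep (level x) = level_rep x.
Proof. by move=> nx; rewrite /level; case: pselect. Qed.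

Lemma same_level_level x : x <> hzero -> same_level x (rep (level x)).
Proof. by move=> nx; rewrite rep_level//; case: (level_repP nx). Qed.

Lemma level_eq x y : x <> hzero -> y <> hzero -> same_level x y -> level x = level y.
Proof. by move=> nx ny xy; apply: rep_inj; rewrite !rep_level//; exact: level_rep_eq. Qed.

Lemma level_repK g : level (rep g) = g.
Proof. by apply: rep_inj; rewrite rep_level; case: g => x []. Qed.

Definition degree_mul g h := level (rep g ** rep h).
Definition degree_inv g := level (rep g)^i.
(** Dominating elements receive the smaller degree, so that the lowest term of a series is the one
    that absorbs the others. *)
Definition degree_lt g h := dominates (rep g) (rep h).

Lemma levelM x y : x <> hzero -> y <> hzero ->
  level (x ** y) = degree_mul (level x) (level y).
Proof.
move=> nx ny; apply: level_eq; try by apply: hmul_neq0 => //; exact: rep_neq0.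
by apply: same_levelM => //; try exact: rep_neq0; exact: same_level_level.
Qed.

Lemma levelV x : x <> hzero -> level x^i = degree_inv (level x).
Proof.
move=> nx; apply: level_eq; try by apply: hinv_neq0 => //; exact: rep_neq0.
by apply: same_levelV => //; try exact: rep_neq0; exact: same_level_level.
Qed.

Lemma level1 : level hone = degree1.
Proof. by rewrite -[RHS]level_repK. Qed.

Lemma degree_mulA : associative degree_mul.
Proof.
move=> g h k; rewrite -[g]level_repK -[h]level_repK -[k]level_repK.
by rewrite -!levelM ?hmulA//; (try apply: hmul_neq0); exact: rep_neq0.
Qed.

Lemma degree_mul1x : left_id degree1 degree_mul.
Proof. by move=> g; rewrite /degree_mul hmul1x level_repK. Qed.

Lemma degree_mulx1 : right_id degree1 degree_mul.
Proof. by move=> g; rewrite /degree_mul hmulx1 level_repK. Qed.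

Lemma degree_mulVx : left_inverse degree1 degree_inv degree_mul.
Proof.
move=> g; have nr := @rep_neq0 g; have nV := hinv_neq0 nr.
by rewrite -[g]level_repK -levelV// -levelM// hmulVx// level1.
Qed.

Lemma degree_mulxV : right_inverse degree1 degree_inv degree_mul.
Proof.
move=> g; have nr := @rep_neq0 g; have nV := hinv_neq0 nr.
by rewrite -[g]level_repK -levelV// -levelM// hmulxV// level1.
Qed.

Lemma level_lt x y : x <> hzero -> y <> hzero -> dominates x y -> degree_lt (level x) (level y).
Proof.
move=> nx ny; apply: dominates_level => //; try exact: rep_neq0; exact: same_level_level.
Qed.

Lemma degree_lt_irr g : ~ degree_lt g g.
Proof. apply: dominates_irr; exact: rep_neq0. Qed.

Lemma degree_lt_trans h g k : degree_lt g h -> degree_lt h k -> degree_lt g k.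
Proof. apply: dominates_trans => //; exact: rep_neq0. Qed.

Lemma degree_lt_total g h : [\/ degree_lt g h, g = h | degree_lt h g].
Proof.
have [gh|gh|hg] := level_trichotomy (@rep_neq0 g) (@rep_neq0 h).
- exact: Or31.
- by apply: Or32; rewrite -[g]level_repK -[h]level_repK; apply: level_eq; try exact: rep_neq0.
- exact: Or33.
Qed.

Lemma degree_lt_mull g h k : degree_lt h k -> degree_lt (degree_mul g h) (degree_mul g k).
Proof.
move=> hk; apply: level_lt; try by apply: hmul_neq0; exact: rep_neq0.
by apply/dominates_mull => //; exact: rep_neq0.
Qed.

Lemma degree_lt_mulr g h k : degree_lt h k -> degree_lt (degree_mul h g) (degree_mul k g).
Proof.
move=> hk; apply: level_lt; try by apply: hmul_neq0; exact: rep_neq0.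
by apply/dominates_mulr => //; exact: rep_neq0.
Qed.

(* A degree [g] and [a : A] encode the homogeneous element with image
   [rep g ** sg a] in [F]; [tw g h] is the product of components in this encoding. *)
Section Residue.
Variables (A : zmodType) (sg : A -> F) (e : A) (tw : degree -> degree -> A -> A -> A).
Implicit Types a b c : A.
Hypothesis sg_eq0 : forall a, sg a = hzero <-> a = 0.
Hypothesis sg_level : forall a, a <> 0 -> same_level (sg a) hone.
Hypothesis sg1 : sg e = hone.
Hypothesis sgD : forall a b, hadd (sg a) (sg b) (sg (a + b)).
Hypothesis sgN : forall a, sg (- a) = hopp (sg a).
Hypothesis sg_surj : forall u, u <> hzero -> same_level u hone -> exists a, sg a = u.
Hypothesis sg_hadd : forall u v w, u <> hzero -> v <> hzero ->
  same_level u hone -> same_level v hone -> hadd u v w ->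
  (exists a b, [/\ sg a = u, sg b = v & sg (a + b) = w]) \/
  [/\ v = hopp u, w <> hzero & dominates hone w].
Hypothesis tw_rep : forall g h a b,
  rep (degree_mul g h) ** sg (tw g h a b) = rep g ** sg a ** (rep h ** sg b).
Hypothesis twDl : forall g h a b c, tw g h (a + b) c = tw g h a c + tw g h b c.
Hypothesis twDr : forall g h a b c, tw g h a (b + c) = tw g h a b + tw g h a c.
Hypothesis twA : forall g h k a b c,
  tw g (degree_mul h k) a (tw h k b c) = tw (degree_mul g h) k (tw g h a b) c.
Hypothesis tw1 : forall g a, tw degree1 g e a = a.
Hypothesis tw1r : forall g a, tw g degree1 a e = a.
Hypothesis tw_inv : forall g a, a != 0 -> exists b, tw g (degree_inv g) a b = e.

Let e_neq0 : e != 0.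
Proof. by apply/eqP => /sg_eq0; rewrite sg1; exact: hone_neq0. Qed.

Let D : graded_division_ring := @GradedDivisionRing degree A
  degree_mul degree1 degree_inv degree_lt degree_mulA degree_mul1x degree_mulx1
  degree_mulVx degree_mulxV degree_lt_irr degree_lt_trans degree_lt_total
  degree_lt_mull degree_lt_mulr tw e e_neq0 twDl twDr twA tw1 tw1r tw_inv.

Let p g a := rep g ** sg a.

Let p_eq0 g a : p g a = hzero <-> a = 0.
Proof.
split=> [pa|->]; last by rewrite /p (sg_eq0 0).2// hmulx0.
apply/sg_eq0; apply: contrapT => na; exact: (hmul_neq0 (@rep_neq0 g) na).
Qed.

Let p_level g a : a <> 0 -> same_level (rep g) (p g a).
Proof.
move=> na; have nsa : sg a <> hzero by move/sg_eq0.
rewrite -[rep g in X in same_level X _]hmulx1.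
apply/same_level_mull => //; [exact: rep_neq0|exact: hone_neq0|].
exact/same_level_sym/sg_level.
Qed.

Let p_surj u : u <> hzero -> exists a, p (level u) a = u.
Proof.
move=> nu; have nr := @rep_neq0 (level u); have nV := hinv_neq0 nr.
have [a ea] : exists a, sg a = (rep (level u))^i ** u.
  apply: sg_surj; first exact: hmul_neq0.
  rewrite -(hmulVx nr); apply/same_level_mull => //; exact: same_level_level.
by exists a; rewrite /p ea hmulKV.
Qed.

Let pD g a b : hadd (p g a) (p g b) (p g (a + b)).
Proof. exact: hadd_mull. Qed.

Let p_dominates g h a b : degree_lt g h -> a <> 0 -> b <> 0 -> dominates (p g a) (p h b).
Proof.
move=> gh na nb; apply: (dominates_level _ _ _ _ _ _ gh) => //; try exact: rep_neq0;
  by [move/p_eq0|exact: p_level].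
Qed.

Let p_dominant g h a b : degree_lt g h -> a <> 0 -> hadd (p g a) (p h b) (p g a).
Proof.
move=> gh na; have [->|nb] := pselect (b = 0); first by rewrite (p_eq0 h 0).2// haddx0.
apply: dominates_hadd => //; [by move/p_eq0|by move/p_eq0|exact: p_dominates].
Qed.

Let p_cancel g h a b : degree_lt g h -> a <> 0 -> hadd (p g a) (p g (- a)) (p h b).
Proof.
move=> gh na; rewrite /p sgN hmulNr -/(p g a) -/(p h b).
by apply/hadd_same_diff; exact: p_dominant.
Qed.

(** On different levels the dominating summand is the whole sum. On a common level, dividing by its
    representative reduces the claim to [sg_hadd]. *)
Let p_hadd u v w : u <> hzero -> v <> hzero -> hadd u v w ->
  [\/ exists g a b, [/\ u = p g a, v = p g b & w = p g (a + b)],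
      exists g h a b, [/\ degree_lt g h, u = p g a, v = p h b & w = u],
      exists g h a b, [/\ degree_lt g h, v = p g a, u = p h b & w = v] |
      exists g h a b, [/\ degree_lt g h, u = p g a, v = p g (- a) & w = p h b]].
Proof.
move=> nu nv uvw; have [[a ua] [b vb]] := (p_surj nu, p_surj nv).
have [uv|uv|vu] := level_trichotomy nu nv.
- apply: Or42; exists (level u), (level v), a, b; split=> //; first exact: level_lt.
  exact: (dominates_hadd_unique hF nu nv uv).
- have eg := level_eq nu nv uv; rewrite -eg in vb.
  set g := level u in ua vb; have nr := @rep_neq0 g; have nV := hinv_neq0 nr.
  have neq0 c x : x <> hzero -> p g c = x -> c <> 0.
    by move=> nx pc c0; apply: nx; rewrite -pc; exact/p_eq0.
  have [na nb] := (neq0 a u nu ua, neq0 b v nv vb).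
  have nsg c : c <> 0 -> sg c <> hzero by move=> nc /sg_eq0.
  have sw : hadd (sg a) (sg b) ((rep g)^i ** w).
    by have := hadd_mull (rep g)^i uvw; rewrite -ua -vb !hmulVK.
  have [[a' [b' [ea eb eab]]]|[ba nw dw]] :=
    sg_hadd (nsg a na) (nsg b nb) (sg_level na) (sg_level nb) sw.
    by apply: Or41; exists g, a', b'; rewrite /p ea eb eab hmulKV.
  have nw' : w <> hzero by move=> w0; apply: nw; rewrite w0 hmulx0.
  have [c wc] := p_surj nw'.
  apply: Or44; exists g, (level w), a, c; split=> //; last by rewrite -vb /p ba sgN.
  rewrite -[g]level_repK; apply: level_lt => //.
  rewrite -[w](hmulKV w nr) -[X in dominates X]hmulx1.
  by apply/dominates_mull.
- apply: Or43; exists (level v), (level u), b, a; split=> //; first exact: level_lt.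
  by apply: (dominates_hadd_unique hF nv nu vu); exact: hadd_comm.
Qed.

Lemma residue_quotient :
  exists (K : skewFieldType) (U : normal_unit_subgroup K), hyperfield_isomorphic F (quot U).
Proof.
apply: (@leading_map_quotient D).
apply: (@LeadingMap D F p) => //.
- by rewrite /p sg1 hmulx1.
- by move=> u /p_surj; exists (level u).
Qed.

End Residue.
End Degrees.

(** * The case of 1 in 1 - 1 *)

Section Absorbing.
Variable F : skewHyperfieldType.
Hypothesis hF : doubly_distributive F.
Hypothesis M1 : M (hone : F).
Local Notation "x ** y" := (hmul x y) (at level 40, left associativity).
Local Notation "x ^i" := (hinv x) (at level 3, format "x ^i").
Implicit Types x y z u v w : F.
Implicit Types a b c q : rat.
Implicit Types g h k : degree F.

Lemma absorbs_in_M z : absorbs z -> M z.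
Proof. by move=> /(_ _ M1); rewrite hmulx1. Qed.

(** Both hypotheses are absorptions: [1 + u] contains 1, and also [u]. Unless [u = -1] this sum is a
    singleton. *)
Lemma unit_of_M u : u <> hzero -> M u -> M u^i -> u = hone \/ u = hopp hone.
Proof.
move=> nu /M_absorbed u1 /M_absorbed /(hadd_mull u); rewrite hmulx1 hmulxV// => /hadd_comm u2.
have [e|ne] := pselect (u = hopp hone); [by right|left].
exact: stringent ne u2 u1.
Qed.

Lemma same_level_unit u : u <> hzero -> same_level u hone -> u = hone \/ u = hopp hone.
Proof.
move=> nu [/absorbs_in_M + /absorbs_in_M]; rewrite hmulx1 hinv1 hmul1x => uV u1.
exact: unit_of_M.
Qed.

(** The signs of an ordered field add like the elements 0, 1, -1 of [F]: equal signs persist, while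
    opposite signs can give any of the three. If [hone = hopp hone], both nonzero signs have the
    same image. *)
Definition sg q : F :=
  if q == 0 then hzero else if 0 < q then hone else hopp hone.

Lemma sg0 : sg 0 = hzero. Proof. by rewrite /sg eqxx. Qed.

Lemma sg_pos q : 0 < q -> sg q = hone.
Proof. by move=> q0; rewrite /sg q0 gt_eqF. Qed.

Lemma sg_neg q : q < 0 -> sg q = hopp hone.
Proof. by move=> q0; rewrite /sg lt_eqF// ltNge (ltW q0). Qed.

Lemma sg_eq0 q : sg q = hzero <-> q = 0.
Proof.
split=> [|->]; last exact: sg0.
case: (ltgtP q 0) => // [/sg_neg|/sg_pos] ->; last by move/hone_neq0.
by move/(@hopp_neq0 _ _ (@hone_neq0 F)).
Qed.

Lemma sg_level q : q <> 0 -> same_level (sg q) hone.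
Proof.
case: (ltgtP q 0) => // [/sg_neg|/sg_pos] -> _; last exact/same_level_refl/hone_neq0.
have nN := hopp_neq0 (@hone_neq0 F); split; last by rewrite hinv1 hmul1x; exact/absorbsN/absorbs1.
suff -> : (hopp hone)^i ** hone = hopp hone :> F by exact/absorbsN/absorbs1.
by apply: (hmul_inj nN); rewrite hmulKV// hmulNr hmulx1 hoppK.
Qed.

Lemma sg1 : sg 1 = hone. Proof. exact: sg_pos. Qed.

Lemma sgN q : sg (- q) = hopp (sg q).
Proof.
case: (ltgtP q 0) => [q0|q0|->]; last by rewrite oppr0 sg0 hopp0.
  by rewrite (sg_neg q0) sg_pos ?hoppK// oppr_gt0.
by rewrite (sg_pos q0) sg_neg// oppr_lt0.
Qed.

Lemma sgM a b : sg (a * b) = sg a ** sg b.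
Proof.
case: (ltgtP a 0) => [a0|a0|->]; last by rewrite mul0r sg0 hmul0x.
  rewrite (sg_neg a0) hmulNl hmul1x -sgN.
  case: (ltgtP b 0) => [b0|b0|->]; last by rewrite mulr0 oppr0.
    by rewrite !sg_pos// ?oppr_gt0// nmulr_rgt0.
  by rewrite !sg_neg// ?oppr_lt0// nmulr_rlt0.
rewrite (sg_pos a0) hmul1x.
case: (ltgtP b 0) => [b0|b0|->]; last by rewrite mulr0.
  by rewrite !sg_neg// pmulr_rlt0.
by rewrite !sg_pos// pmulr_rgt0.
Qed.

Lemma M_sg q : M (sg q).
Proof.
case: (ltgtP q 0) => [q0|q0|->]; last by rewrite sg0; exact: M0.
  by rewrite sg_neg//; exact: MN.
by rewrite sg_pos.
Qed.

Lemma sgD a b : hadd (sg a) (sg b) (sg (a + b)).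
Proof.
have pos c d : 0 < c -> hadd (sg c) (sg d) (sg (c + d)).
  move=> c0; rewrite (sg_pos c0); case: (ltgtP d 0) => [d0|d0|->].
  - by rewrite (sg_neg d0); exact: M_sg.
  - by rewrite !sg_pos//; [exact/M_absorbed | exact: addr_gt0].
  - by rewrite addr0 (sg_pos c0) sg0 haddx0.
case: (ltgtP a 0) => [a0|a0|->]; last by rewrite add0r sg0 hadd0x.
  have := haddNN (pos (- a) (- b) _); rewrite -opprD !sgN !hoppK; apply.
  by rewrite oppr_gt0.
exact: pos.
Qed.

Lemma sg_surj u : u <> hzero -> same_level u hone -> exists q, [/\ sg q = u & q = 1 \/ q = -1].
Proof.
move=> nu /(same_level_unit nu) [->|->]; [exists 1|exists (-1)]; rewrite ?sgN sg1.
  by split=> //; left.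
by split=> //; right.
Qed.

Lemma sg_hadd u v w : u <> hzero -> v <> hzero ->
  same_level u hone -> same_level v hone -> hadd u v w ->
  (exists a b, [/\ sg a = u, sg b = v & sg (a + b) = w]) \/
  [/\ v = hopp u, w <> hzero & dominates hone w].
Proof.
move=> nu nv lu lv uvw; have [a [au a1]] := sg_surj nu lu.
have [vu|nvu] := pselect (v = hopp u); last first.
  (* The level of 1 contains only 1 and -1, so two elements that are not opposite are equal. *)
  left; exists a, a; have e : v = u.
    move: (same_level_unit nu lu) (same_level_unit nv lv) nvu.
    by move=> [->|->] [->|->] //; rewrite hoppK.
  rewrite au e; split=> //; apply: (stringent hF nvu _ uvw).
  by rewrite e -au; exact: sgD.
have [->|nw] := pselect (w = hzero).
  by left; exists a, (- a); rewrite sgN au vu subrr sg0.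
have [dw|ndw] := pselect (dominates hone w); [by right|left].
(* Since 1 does not dominate [w], both [w] and its inverse turn out to lie in [M], which makes [w]
   equal to 1 or -1. *)
have Mw : M w.
  have := hadd_mull u^i uvw; rewrite hmulVx// vu hmulNr hmulVx// -/M => Muw.
  rewrite -[w](hmulKV w nu); apply: MM => //; rewrite -au; exact: M_sg.
have MwV : M w^i by have /contrapT/absorbs_in_M := ndw; rewrite hmulx1.
have lw : same_level w hone.
  by split; rewrite ?hinv1 ?hmulx1 ?hmul1x; exact: absorbs_M.
have [d [dw d1]] := sg_surj nw lw.
(* With [a] and [d] equal to 1 or -1, doubling [a] keeps its sign and ensures that [d - (a + a)] has
   the opposite sign even when [d = a]. *)
exists (a + a), (d - (a + a)); split; last by rewrite addrC subrK.
  by rewrite -au; case: a1 => ->; [rewrite !sg_pos | rewrite !sg_neg].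
rewrite vu -au -sgN.
by case: a1 => ->; case: d1 => ->; first [rewrite !sg_pos//; lra | rewrite !sg_neg//; lra].
Qed.

(** A product of representatives agrees up to sign with the representative of its level; this
    rational number records the sign. Preferring 1 settles the ambiguity when [hone = hopp hone]. *)
Definition cocycle g h : rat :=
  if pselect (rep g ** rep h = rep (degree_mul g h)) then 1 else -1.

Lemma cocycle_pm1 g h : cocycle g h = 1 \/ cocycle g h = -1.
Proof. by rewrite /cocycle; case: pselect; [left|right]. Qed.

Lemma cocycle_eq1 g h : rep g ** rep h = rep (degree_mul g h) -> cocycle g h = 1.
Proof. by rewrite /cocycle; case: pselect. Qed.

Lemma cocycle_neq0 g h : cocycle g h != 0.
Proof. by case: (cocycle_pm1 g h) => ->. Qed.

Lemma cocycle_rep g h : rep (degree_mul g h) ** sg (cocycle g h) = rep g ** rep h.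
Proof.
rewrite /cocycle; case: pselect => [e|ne] /=; first by rewrite sg1 hmulx1 e.
have ng := @rep_neq0 _ g; have nh := @rep_neq0 _ h.
have ngh := @rep_neq0 _ (degree_mul g h); have nV := hinv_neq0 ngh.
have nm := hmul_neq0 ng nh.
rewrite sgN sg1; set r := rep (degree_mul g h) in ne ngh nV *.
have : same_level (r^i ** (rep g ** rep h)) hone.
  by rewrite -(hmulVx ngh); apply/same_level_mull => //; exact: same_level_level.
case/same_level_unit => [|e|<-]; first exact: hmul_neq0.
  by case: ne; rewrite -[LHS](hmulKV _ ngh) e hmulx1.
by rewrite hmulKV.
Qed.

Lemma sg_central q x : sg q ** x = x ** sg q.
Proof.
case: (ltgtP q 0) => [q0|q0|->]; last by rewrite sg0 hmul0x hmulx0.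
  by rewrite sg_neg// hmulNl hmulNr hmul1x hmulx1.
by rewrite sg_pos// hmul1x hmulx1.
Qed.

Lemma cocycleA g h k : cocycle g (degree_mul h k) * cocycle h k =
  cocycle (degree_mul g h) k * cocycle g h.
Proof.
(* When [hone = hopp hone] the map [sg] cannot separate 1 from -1, but the cocycle is then
   constantly 1. Otherwise the identity is tested after [sg], where it is associativity of the
   product of three representatives. *)
have [e1|n1] := pselect (hone = hopp hone :> F).
  have all1 g' h' : cocycle g' h' = 1.
    apply: cocycle_eq1; rewrite -cocycle_rep.
    by case: (cocycle_pm1 g' h') => ->; rewrite ?sgN sg1 -?e1 hmulx1.
  by rewrite !all1.
have sg_inj a b : a = 1 \/ a = -1 -> b = 1 \/ b = -1 -> sg a = sg b -> a = b.
  by move=> [->|->] [->|->] //; rewrite sgN sg1 // => e; case: n1.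
have pm a b : a = 1 \/ a = -1 -> b = 1 \/ b = -1 -> a * b = 1 \/ a * b = -1.
  by move=> [->|->] [->|->]; rewrite ?mul1r ?mulr1 ?mulrNN ?mulr1; tauto.
apply: sg_inj; [by apply: pm; exact: cocycle_pm1..|].
have nr := @rep_neq0 _ (degree_mul g (degree_mul h k)).
apply: (hmul_inj nr); rewrite !sgM !hmulA cocycle_rep -hmulA cocycle_rep.
rewrite (degree_mulA g h k) cocycle_rep -hmulA -sg_central [in RHS]hmulA cocycle_rep.
by rewrite hmulA.
Qed.

(** The graded ring is the group ring of the degrees over the rationals, twisted by [cocycle]. *)
Lemma absorbing_quotient :
  exists (K : skewFieldType) (U : normal_unit_subgroup K), hyperfield_isomorphic F (quot U).
Proof.
apply: (@residue_quotient F hF rat sg 1 (fun g h a b => cocycle g h * (a * b))).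
- exact: sg_eq0.
- exact: sg_level.
- exact: sg1.
- exact: sgD.
- exact: sgN.
- by move=> u nu /(sg_surj nu) [q [qu _]]; exists q.
- exact: sg_hadd.
- move=> g h a b; rewrite !sgM hmulA cocycle_rep !hmulA; congr hmul.
  by rewrite -!hmulA sg_central.
- by move=> *; rewrite !mulrDl mulrDr.
- by move=> *; rewrite !mulrDr.
- move=> g h k a b c.
  have -> : cocycle g (degree_mul h k) * (a * (cocycle h k * (b * c))) =
      cocycle g (degree_mul h k) * cocycle h k * (a * b * c) by ring.
  by rewrite cocycleA; ring.
- by move=> g a; rewrite cocycle_eq1 ?degree_mul1x ?hmul1x// !mul1r.
- by move=> g a; rewrite cocycle_eq1 ?degree_mulx1 ?hmulx1// mul1r mulr1.
- move=> g a a0; exists (cocycle g (degree_inv g) * a)^-1.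
  have c0 := cocycle_neq0 g (degree_inv g).
  by rewrite mulrA mulfV// mulf_neq0.
Qed.

End Absorbing.

(** * The case of 1 not in 1 - 1 *)

Section ResidueField.
Variable F : skewHyperfieldType.
Hypothesis hF : doubly_distributive F.
Hypothesis nM1 : ~ M (hone : F).
Local Notation "x ** y" := (hmul x y) (at level 40, left associativity).
Local Notation "x ^i" := (hinv x) (at level 3, format "x ^i").
Implicit Types x y z u v w t : F.

(** These elements serve as the residue skew field itself, without passing to classes modulo [M]: a
    nonzero one absorbs every element of [M]. *)
Definition residual x := x <> hzero -> same_level x hone.

Lemma residual0 : residual hzero. Proof. by []. Qed.

Lemma residual1 : residual hone.
Proof. by move=> n1; exact: same_level_refl. Qed.

Lemma same_levelN x : x <> hzero -> same_level (hopp x) x.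
Proof.
move=> nx; have nN := hopp_neq0 nx; split; last by rewrite hmulNr hmulVx//; exact/absorbsN/absorbs1.
suff -> : (hopp x)^i ** x = hopp hone by exact/absorbsN/absorbs1.
by apply: (hmul_inj nN); rewrite hmulKV// hmulNr hmulx1 hoppK.
Qed.

Lemma residualN x : residual x -> residual (hopp x).
Proof.
move=> rx nN; have nx : x <> hzero by move=> x0; apply: nN; rewrite x0 hopp0.
by apply: (@same_level_trans _ x) => //; [exact: same_levelN | exact: rx].
Qed.

Lemma residual_M z : residual z -> M z -> z = hzero.
Proof.
move=> rz Mz; apply: contrapT => nz; apply: nM1.
by have [/(_ _ Mz)] := rz nz; rewrite hmulx1 hmulVx.
Qed.

Lemma dominates1_of_M w : w <> hzero -> M w -> dominates hone w.
Proof. by move=> nw Mw /(_ _ Mw); rewrite hmulx1 hmulVx. Qed.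

Lemma residual_diff_M x w : residual x -> hadd x (hopp x) w -> M w.
Proof.
move=> rx; have [->|nx] := pselect (x = hzero).
  by rewrite hopp0 hadd0x => ->; exact: M0.
move=> /(M_scale _ nx) Mxw; rewrite -(hmulKV w nx).
by have [_] := rx nx; rewrite hinv1 hmul1x; apply.
Qed.

(** For [y = -x] the sums all lie in [M], whose only residual element is zero; otherwise there is
    only one sum. *)
Lemma residual_unique x y w w' : residual x -> residual w -> residual w' ->
  hadd x y w -> hadd x y w' -> w = w'.
Proof.
move=> rx rw rw'; have [->|ny] := pselect (y = hopp x); last exact: stringent.
by move=> /(residual_diff_M rx)/(residual_M rw) -> /(residual_diff_M rx)/(residual_M rw').
Qed.

(** For nonzero [x] and [y] with [y <> hopp x], a sum [z] cannot leave the level of 1. As [x] lies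
    in [z - y], a larger [z] would give [x = z], and a smaller one [x = -y]. *)
Lemma residual_exists x y : residual x -> residual y -> exists2 w, residual w & hadd x y w.
Proof.
move=> rx ry; have [->|ny] := pselect (y = hopp x).
  by exists hzero; [exact: residual0 | exact: hadd_opp].
have [x0|nx] := pselect (x = hzero); first by exists y; rewrite // x0 hadd0x.
have [y0|ny0] := pselect (y = hzero); first by exists x; rewrite // y0 haddx0.
have [z xyz] := hadd_nonempty x y; exists z => // nz.
have n1 := @hone_neq0 F.
have [z1|//|z1] := level_trichotomy nz n1; exfalso.
  have nN := hopp_neq0 ny0.
  have zx : dominates z x.
    apply: (dominates_level _ _ _ _ _ _ z1) => //; first exact: same_level_refl.
    exact/same_level_sym/rx.
  have zN : dominates z (hopp y).
    apply: (dominates_level _ _ _ _ _ _ z1) => //; first exact: same_level_refl.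
    exact/same_level_sym/residualN.
  have xz := dominates_hadd_unique hF nz nN zN (hadd_subr xyz).
  by rewrite xz in zx; exact: dominates_irr zx.
have nN := hopp_neq0 ny0.
have Nz : dominates (hopp y) z.
  apply: (dominates_level _ _ _ _ _ _ z1) => //; last exact: same_level_refl.
  exact/same_level_sym/residualN.
have xN := dominates_hadd_unique hF nN nz Nz (hadd_comm (hadd_subr xyz)).
by apply: ny; rewrite xN hoppK.
Qed.

(** * The additive group of the residue skew field *)

Definition residue : Type := {x : F | residual x}.

HB.instance Definition _ := gen_eqMixin residue.
HB.instance Definition _ := gen_choiceMixin residue.

Definition rval (a : residue) : F := sval a.
Implicit Types a b c : residue.

Lemma rval_inj a b : rval a = rval b -> a = b.
Proof.
case: a b => [x px] [y py] /= xy; case: _ / xy in py *.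
by congr exist; exact: Prop_irrelevance.
Qed.

Lemma rvalP a : residual (rval a). Proof. exact: (proj2_sig a). Qed.

Lemma rval_surj x : residual x -> exists a, rval a = x.
Proof. by move=> rx; exists (exist _ x rx). Qed.

Let add_exists a b : exists c, hadd (rval a) (rval b) (rval c).
Proof.
have [w /rval_surj [c <-] abw] := residual_exists (@rvalP a) (@rvalP b).
by exists c.
Qed.

Definition residue_zero : residue := exist _ hzero residual0.
Definition residue_one : residue := exist _ hone residual1.
Definition residue_add a b : residue := sval (cid (add_exists a b)).
Definition residue_opp a : residue := exist _ _ (residualN (@rvalP a)).

Lemma rval_add a b : hadd (rval a) (rval b) (rval (residue_add a b)).
Proof. by rewrite /residue_add; case: cid. Qed.

Lemma residue_addP a b c : hadd (rval a) (rval b) (rval c) -> residue_add a b = c.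
Proof.
move=> abc; apply: rval_inj; apply: residual_unique (rval_add a b) abc; exact: rvalP.
Qed.

Let residue_addC : commutative residue_add.
Proof. by move=> a b; apply: residue_addP; apply: hadd_comm; exact: rval_add. Qed.

Let residue_add0 : left_id residue_zero residue_add.
Proof. by move=> a; apply: residue_addP; rewrite hadd0x. Qed.

Let residue_addN : left_inverse residue_zero residue_opp residue_add.
Proof. by move=> a; apply: residue_addP; apply: hadd_comm; exact: hadd_opp. Qed.

(** Associativity in [F] gives [t] in [a + b] such that [t + c] contains the right-bracketed sum.
    Only for [b = -a] can [t] differ from the residue sum; then [t] lies in [M], so a nonzero [c]
    absorbs it, while for [c = 0] the sum is residual and in [M], hence zero. *)
Let residue_addA : associative residue_add.
Proof.
move=> a b c; apply/esym; set w := residue_add a (residue_add b c).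
have [t abt tcw] := hadd_assocl (rval_add b c) (rval_add a (residue_add b c)).
rewrite -/w in tcw.
have [ba|nba] := pselect (rval b = hopp (rval a)); last first.
  by apply: residue_addP; rewrite (stringent hF nba (rval_add a b) abt).
have -> : residue_add a b = residue_zero by apply: residue_addP; rewrite ba; exact: hadd_opp.
rewrite residue_add0; apply: rval_inj; rewrite ba in abt.
have Mt := residual_diff_M (@rvalP a) abt.
have [c0|nc] := pselect (rval c = hzero).
  rewrite c0 haddx0 in tcw; rewrite c0; apply/esym/residual_M; first exact: rvalP.
  by rewrite tcw.
have [t0|nt] := pselect (t = hzero); first by rewrite t0 hadd0x in tcw; rewrite tcw.
apply/esym; apply: (dominates_hadd_unique hF nc nt _ (hadd_comm tcw)).
have n1 := @hone_neq0 F.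
apply: (dominates_level _ _ _ _ _ _ (dominates1_of_M nt Mt)) => //; last exact: same_level_refl.
by apply: same_level_sym; exact: rvalP.
Qed.

#[local] HB.instance Definition _ := GRing.isZmodule.Build residue
  residue_addA residue_addC residue_add0 residue_addN.

Lemma rvalD a b : hadd (rval a) (rval b) (rval (a + b)).
Proof. exact: rval_add. Qed.

Lemma rvalDP a b c : hadd (rval a) (rval b) (rval c) -> a + b = c.
Proof. exact: residue_addP. Qed.

Lemma rval_eq0 a : rval a = hzero <-> a = 0.
Proof. by split=> [e|->//]; apply: rval_inj; rewrite e. Qed.

Lemma rvalN a : rval (- a) = hopp (rval a).
Proof. by []. Qed.

(** * Products of homogeneous components over the residue skew field *)

Implicit Types g h k : degree F.

Let twist_residual g h a b :
  residual ((rep (degree_mul g h))^i ** (rep g ** rval a ** (rep h ** rval b))).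
Proof.
set r := rep _; have nr : r <> hzero by exact: rep_neq0.
have ng := @rep_neq0 _ g; have nh := @rep_neq0 _ h; have n1 := @hone_neq0 F.
have [a0|na] := pselect (rval a = hzero).
  by rewrite a0 hmulx0 hmul0x hmulx0 => ?; exact: residual0.
have [b0|nb] := pselect (rval b = hzero).
  by rewrite b0 !hmulx0 => ?; exact: residual0.
have nV := hinv_neq0 nr.
have [nga nhb] := (hmul_neq0 ng na, hmul_neq0 nh nb).
move=> _; rewrite -(hmulVx nr); apply/same_level_mull => //; first exact: hmul_neq0.
apply: (@same_level_trans _ (rep g ** rep h)); first exact: hmul_neq0.
  apply: same_levelM => //; rewrite -[X in same_level _ X]hmulx1;
    by apply/same_level_mull => //; exact: rvalP.
by apply: same_level_level; exact: hmul_neq0.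
Qed.

Definition twist g h a b : residue := exist _ _ (@twist_residual g h a b).

Lemma rval_twist g h a b :
  rep (degree_mul g h) ** rval (twist g h a b) = rep g ** rval a ** (rep h ** rval b).
Proof. by rewrite hmulKV//; exact: rep_neq0. Qed.

Lemma twist_inj g a b : rep g ** rval a = rep g ** rval b -> a = b.
Proof. by move/(hmul_inj (@rep_neq0 _ g)); exact: rval_inj. Qed.

Lemma residue_field_quotient :
  exists (K : skewFieldType) (U : normal_unit_subgroup K), hyperfield_isomorphic F (quot U).
Proof.
apply: (@residue_quotient F hF residue rval residue_one twist).
- exact: rval_eq0.
- by move=> a na; apply: rvalP; move/rval_eq0.
- by [].
- exact: rvalD.
- exact: rvalN.
- by move=> u _ u1; apply: rval_surj.
- move=> u v w nu nv u1 v1 uvw.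
  have [[a au] [b bv]] := (@rval_surj u (fun=> u1), @rval_surj v (fun=> v1)).
  have [vu|nvu] := pselect (v = hopp u); last first.
    left; exists a, b; split=> //; apply: (stringent hF nvu _ uvw).
    by rewrite -au -bv; exact: rvalD.
  have [w0|nw] := pselect (w = hzero).
    left; exists a, b; split=> //; rewrite w0; apply/rval_eq0/rvalDP.
    by rewrite au bv vu; exact: hadd_opp.
  right; split=> //; apply: dominates1_of_M => //.
  by apply: (@residual_diff_M u); rewrite -?vu.
- exact: rval_twist.
- move=> g h a b c; apply/esym/rvalDP; apply: hadd_mull.
  by rewrite !hmulA; do 2 apply: hadd_mulr; apply: hadd_mull; exact: rvalD.
- move=> g h a b c; apply/esym/rvalDP; do 3 apply: hadd_mull; exact: rvalD.
- move=> g h k a b c; apply: (@twist_inj (degree_mul g (degree_mul h k))).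
  by rewrite rval_twist rval_twist degree_mulA rval_twist rval_twist !hmulA.
- move=> g a; apply: (@twist_inj (degree_mul (degree1 F) g)).
  by rewrite rval_twist degree_mul1x /= !hmul1x.
- move=> g a; apply: (@twist_inj (degree_mul g (degree1 F))).
  by rewrite rval_twist degree_mulx1 /= !hmulx1.
move=> g a a0; have na : rval a <> hzero by move/rval_eq0/eqP; apply/negP.
have nX := hmul_neq0 (@rep_neq0 _ g) na; set X := _ ** _ in nX.
have nV := hinv_neq0 nX; have nr := @rep_neq0 _ (degree_inv g).
have eX : level X = g.
  rewrite -[RHS]level_repK; apply: level_eq => //; first exact: rep_neq0.
  rewrite -[X in same_level _ X]hmulx1; have ng := @rep_neq0 _ g; have n1 := @hone_neq0 F.
  by apply/same_level_mull => //; exact: rvalP.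
(* The inverse of the homogeneous element [X] has degree [degree_inv g]; dividing it by the
   representative of that degree leaves a residual element. *)
have [b eb] : exists b, rval b = (rep (degree_inv g))^i ** X^i.
  apply: rval_surj => _; have nrV := hinv_neq0 nr.
  rewrite -(hmulVx nr); apply/same_level_mull => //.
  by have := same_level_level nV; rewrite levelV// eX.
exists b; apply: (@twist_inj (degree_mul g (degree_inv g))).
by rewrite rval_twist eb hmulKV// hmulxV// degree_mulxV /= hmul1x.
Qed.

End ResidueField.

Theorem corollary7p6 (F : skewHyperfieldType) (hF : doubly_distributive F) :
  exists (K : skewFieldType) (U : normal_unit_subgroup K),
    hyperfield_isomorphic F (quot U).
Proof.
have [M1|nM1] := pselect (M (hone : F)).
  exact: absorbing_quotient.
exact: residue_field_quotient.
Qed.
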